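(* Let $Q$ be a finite acyclic quiver and $k=\mathbb{C}$. If $L$ is a stable $\mathcal{R}$-module belonging to $\mathcal{M}(v,w)$ and $K_{LR}(\mathrm{res}\,L)$ is of dimension vector $(v^0,w)$, then the unique closed $G_v$-orbit in the closure of $G_vL$ in the affine variety $\mathrm{rep}(\mathcal{R}^{op},v,w)$ of representations of $\mathcal{R}^{op}$ of dimension vector $(v,w)$ is that of $K_{LR}(\mathrm{res}\,L)\oplus S$, where $S$ is the semi-simple $k(\mathbb{Z}Q)$-module of dimension vector $v-v^0$.
   Context: $k=\mathbb{C}$. Repetition quiver: $\mathbb{Z}Q$ has vertices $(i,p)$, $i\in Q_0$, $p\in\mathbb{Z}$, and for each arrow $\alpha:i\to j$ and $p\in\mathbb{Z}$ arrows $(\alpha,p):(i,p)\to(j,p)$ and $\sigma(\alpha,p):(j,p-1)\to(i,p)$. Put $\tau(i,p)=(i,p-1)$, and for an arrow $\beta$ put $\sigma(\beta)=\sigma(\alpha,p)$ if $\beta=(\alpha,p)$ and $\sigma(\beta)=(\alpha,p-1)$ if $\beta=\sigma(\alpha,p)$. The mesh relator $r_x$ is the sum over all arrows $\beta:y\to x$ of the paths $\tau(x)\xrightarrow{\sigma(\beta)}y\xrightarrow{\beta}x$. The mesh category $k(\mathbb{Z}Q)$ has objects the vertices of $\mathbb{Z}Q$ and morphisms the linear combinations of paths modulo the ideal generated by all $r_x$. Nakajima categories: $\tilde{Q}$ is obtained from $Q$ by adding for each $i\in Q_0$ a new vertex $i'$ and an arrow $i\to i'$. The vertices $(i',p)$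 of $\mathbb{Z}\tilde{Q}$ are frozen, the $(i,p)$, $i\in Q_0$, non frozen. For non frozen $x=(i,p)$ put $\sigma(x)=(i',p-1)$. $\mathcal{R}$ has objects the vertices of $\mathbb{Z}\tilde{Q}$ and morphisms linear combinations of paths modulo the ideal generated by the $r_x$ for non frozen $x$ only. $\mathcal{S}$ is the full subcategory of $\mathcal{R}$ on the frozen vertices. Modules are right modules ($k$-linear contravariant functors to $\mathrm{Mod}\,k$), $S_u$ is the simple module concentrated at $u$. One has $\mathcal{R}/\langle\mathcal{S}\rangle\cong k(\mathbb{Z}Q)$, where $\langle\mathcal{S}\rangle$ is the ideal generated by the identities of the objects of $\mathcal{S}$, so that $k(\mathbb{Z}Q)$-modules are the $\mathcal{R}$-modules vanishing on frozen vertices. Dimension vectors are functions with finite support $v$ on non frozen vertices and $w$ on frozen vertices. $\mathrm{rep}(\mathcal{R}^{op},v,w)$ is the affine variety of $\mathcal{R}$-modules $M$ with $M(x)=k^{v(x)}$ and $M(u)=k^{w(u)}$ for $x$ non frozen and $u$ frozen; $G_v=\prod_xGL(k^{v(x)})$ ($x$ non frozen) acts on it by base change. A finite-dimensional $\mathcal{R}$-module $M$ is stable if $\mathrm{Hom}_{\mathcal{R}}(S_x,M)=0$ for all non frozen $x$; $\tilde{\mathcal{M}}(v,w)\subset\mathrm{rep}(\mathcal{R}^{op},v,w)$ is the subset of stable modules and $\mathcal{M}(v,w)=\tilde{\mathcal{M}}(v,w)/G_v$. That $L$ belongs to $\mathcal{M}(v,w)$ means that its class is a point of it. The orbit of a module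 is the orbit of the corresponding point(s) of $\mathrm{rep}(\mathcal{R}^{op},v,w)$ (identifying the restriction to $\mathcal{S}$ of $K_{LR}(\mathrm{res}\,L)$ canonically with $\mathrm{res}\,L$). Kan extensions: $K_L$ and $K_R$ are the left and right adjoints of the restriction functor $\mathrm{res}:\mathrm{Mod}(\mathcal{R})\to\mathrm{Mod}(\mathcal{S})$; there is a canonical morphism $K_L\to K_R$ (restricting to the identity), and $K_{LR}(M)$ is the image of $K_L(M)\to K_R(M)$. *)

(* Defs.v *)
From HB Require Import structures.
From mathcomp Require Import all_boot all_order all_algebra finmap.
From mathcomp Require Import generic_quotient ring_quotient.
From mathcomp Require Import boolp classical_sets reals complex.
From mathcomp Require Import monalg.

Set Implicit Arguments.
Unset Strict Implicit.
Unset Printing Implicit Defensive.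

Import GRing.Theory.
Local Open Scope ring_scope.

#[local] Obligation Tactic := idtac.

Section Subspace.
Variables (k : fieldType) (V : lmodType k).

Record subspace := Subspace {
  subspace_mem :> V -> Prop;
  subspace0 : subspace_mem 0;
  subspaceL : forall a u v,
    subspace_mem u -> subspace_mem v -> subspace_mem (a *: u + v) }.

Variable I : subspace.

Definition subspace_pred : pred V := fun v => `[< I v >].

Lemma subspace_predP v : reflect (I v) (v \in subspace_pred).
Proof. by rewrite unfold_in; exact: asboolP. Qed.

Lemma subspace_closed : submod_closed subspace_pred.
Proof.
split; first by apply/subspace_predP; exact: subspace0.
by move=> a u v /subspace_predP Iu /subspace_predP Iv;
  apply/subspace_predP; exact: subspaceL.
Qed.

HB.instance Definition _ :=
  GRing.isSubmodClosed.Build k V subspace_pred subspace_closed.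

Let subspace_zmod : zmodClosed V := GRing.ZmodClosed.clone V subspace_pred _.

Record subspace_type := SubspaceElt {
  subspace_val : V;
  subspace_valP : subspace_val \in subspace_pred }.
HB.instance Definition _ := [isSub for subspace_val].
HB.instance Definition _ := [Choice of subspace_type by <:].
HB.instance Definition _ := [SubChoice_isSubLmodule of subspace_type by <:].

Definition quot_space : Type := Quotient.quot subspace_zmod.
HB.instance Definition _ := GRing.Zmodule.on quot_space.

Definition qpi (v : V) : quot_space := (\pi_(Quotient.quot subspace_zmod) v)%qT.
Definition qrepr (q : quot_space) : V := repr (q : Quotient.quot subspace_zmod).

Lemma qreprK q : qpi (qrepr q) = q. Proof. exact: reprK. Qed.

Lemma qpiP u v : qpi u = qpi v <-> I (u - v).
Proof.
split=> [/eqP|Iuv].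
  by rewrite -(Quotient.idealrBE subspace_zmod) => /subspace_predP.
by apply/eqP; rewrite -(Quotient.idealrBE subspace_zmod); exact/subspace_predP.
Qed.

Lemma qrepr_pi v : I (qrepr (qpi v) - v).
Proof. by apply/qpiP; rewrite qreprK. Qed.

Lemma qpiD u v : qpi (u + v) = qpi u + qpi v.
Proof. by rewrite /qpi !piE. Qed.

Definition qscale (a : k) (q : quot_space) : quot_space := qpi (a *: qrepr q).

Lemma subspaceZ a v : I v -> I (a *: v).
Proof. by move=> Iv; rewrite -[_ *: _]addr0; apply: subspaceL=> //; exact: subspace0. Qed.

Lemma qpiZ a v : qpi (a *: v) = qscale a (qpi v).
Proof.
by apply/esym/qpiP; rewrite -scalerBr; apply: subspaceZ; exact: qrepr_pi.
Qed.

Lemma qscaleA a b q : qscale a (qscale b q) = qscale (a * b) q.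
Proof. by rewrite -[q]qreprK -!qpiZ scalerA. Qed.
Lemma qscale1 : left_id 1 qscale.
Proof. by move=> q; rewrite -[q]qreprK -!qpiZ scale1r. Qed.
Lemma qscaleDr : right_distributive qscale +%R.
Proof.
by move=> a p q; rewrite -[p]qreprK -[q]qreprK -!qpiZ -!qpiD -!qpiZ scalerDr.
Qed.
Lemma qscaleDl q : {morph qscale^~ q : a b / a + b}.
Proof. by move=> a b; rewrite -[q]qreprK -!qpiZ -!qpiD scalerDl. Qed.

HB.instance Definition _ := GRing.Zmodule_isLmodule.Build k quot_space
  qscaleA qscale1 qscaleDr qscaleDl.

Lemma qpi_linear : linear qpi.
Proof. by move=> a u v; rewrite qpiD qpiZ. Qed.

End Subspace.

Section LinearCategories.
Variable k : fieldType.

Record lincat := LinCat {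
  obj :> Type;
  hom : obj -> obj -> lmodType k;
  idm : forall x, hom x x;
  hcomp : forall x y z, hom y z -> hom x y -> hom x z;
  hcomp_linl : forall x y z (f : hom x y), linear (fun g : hom y z => hcomp g f);
  hcomp_linr : forall x y z (g : hom y z), linear (fun f : hom x y => hcomp g f);
  hcomp1m : forall x y (f : hom x y), hcomp (idm y) f = f;
  hcompm1 : forall x y (f : hom x y), hcomp f (idm x) = f;
  hcompA : forall x y z t (h : hom z t) (g : hom y z) (f : hom x y),
    hcomp h (hcomp g f) = hcomp (hcomp h g) f }.

(* Right modules: k-linear contravariant functors to vector spaces *)
Record rmod (A : lincat) := RMod {
  mobj :> A -> lmodType k;
  mact : forall x y : A, hom x y -> mobj y -> mobj x;
  mact_linl : forall (x y : A) (m : mobj y), linear (fun f : hom x y => mact f m);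
  mact_linr : forall (x y : A) (f : hom x y), linear (mact f);
  mact1 : forall (x : A) (m : mobj x), mact (idm x) m = m;
  mactM : forall (x y z : A) (g : hom y z) (f : hom x y) (m : mobj z),
    mact (hcomp g f) m = mact f (mact g m) }.

Record rmor (A : lincat) (M N : rmod A) := RMor {
  mfun :> forall x : A, M x -> N x;
  mfun_lin : forall x, linear (@mfun x);
  mfun_nat : forall (x y : A) (f : hom x y) (m : M y),
    mfun (mact f m) = mact f (mfun m) }.

Lemma rmorP (A : lincat) (M N : rmod A) (f g : rmor M N) :
  (forall x m, f x m = g x m) -> f = g.
Proof.
case: f g => [f fl fn] [g gl gn] /= fg.
have {}fg : f = g by apply: functional_extensionality_dep => x; apply/funext => m; exact: fg.
by case: _ / fg in gl gn *; congr RMor; exact: Prop_irrelevance.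
Qed.

Definition is_iso (A : lincat) (M N : rmod A) (f : rmor M N) : Prop :=
  forall x, bijective (f x).

Section FullSubcategory.
Variables (A : lincat) (O : Type) (iota : O -> A).

Program Definition full_sub : lincat :=
  @LinCat O (fun u v => hom (iota u) (iota v)) (fun u => idm (iota u))
    (fun u v w g f => hcomp g f) _ _ _ _ _.
Next Obligation. by move=> x y z f; apply: hcomp_linl. Qed.
Next Obligation. by move=> x y z g; apply: hcomp_linr. Qed.
Next Obligation. by move=> x y f; apply: hcomp1m. Qed.
Next Obligation. by move=> x y f; apply: hcompm1. Qed.
Next Obligation. by move=> x y z t h g f; apply: hcompA. Qed.

Program Definition restr (M : rmod A) : rmod full_sub :=
  @RMod full_sub (fun u => M (iota u)) (fun u v f m => mact (f : hom (iota u) (iota v)) m)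
    _ _ _ _.
Next Obligation. by move=> M x y m; exact: (@mact_linl A M (iota x) (iota y) m). Qed.
Next Obligation. by move=> M x y f; exact: (@mact_linr A M (iota x) (iota y) f). Qed.
Next Obligation. by move=> M x m; exact: (@mact1 A M (iota x) m). Qed.
Next Obligation. by move=> M x y z g f m; exact: (@mactM A M (iota x) (iota y) (iota z)). Qed.

Program Definition restr_mor (M N : rmod A) (f : rmor M N) : rmor (restr M) (restr N) :=
  @RMor full_sub (restr M) (restr N) (fun u => f (iota u)) _ _.
Next Obligation. by move=> M N f x; exact: (@mfun_lin A M N f). Qed.
Next Obligation. by move=> M N f x y g m; exact: (@mfun_nat A M N f). Qed.

End FullSubcategory.
End LinearCategories.

Section LinExt.
Variables (k : fieldType) (K : choiceType) (W : lmodType k) (h : K -> W).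

Definition lin_ext (f : {malg k[K]}) : W := \sum_(p <- msupp f) f@_p *: h p.

Lemma lin_extEw (D : {fset K}) f : {subset msupp f <= D} ->
  lin_ext f = \sum_(p <- D) f@_p *: h p.
Proof.
move=> sfD; rewrite /lin_ext; apply: big_fset_incl; first exact/fsubsetP.
by move=> p _ /mcoeff_outdom ->; rewrite scale0r.
Qed.

Lemma lin_ext_linear : linear lin_ext.
Proof.
move=> a f g; pose D := (msupp (a *: f + g) `|` (msupp f `|` msupp g))%fset.
rewrite !(@lin_extEw D) ?scaler_sumr -?big_split /=.
- by apply: eq_bigr => p _; rewrite mcoeffD mcoeffZ scalerDl scalerA.
- by move=> p pg; rewrite !inE pg !orbT.
- by move=> p pf; rewrite !inE pf !orbT.
- by move=> p pfg; rewrite !inE pfg.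
Qed.

Lemma lin_extU p : lin_ext << p >> = h p.
Proof.
by rewrite /lin_ext msuppU oner_eq0 big_seq_fset1 mcoeffUU scale1r.
Qed.

End LinExt.

Section Modules.
Variables (k : fieldType) (A : lincat k).

Record submod (M : rmod A) := Submod {
  submod_at :> forall x : A, subspace (M x);
  submod_act : forall (x y : A) (f : hom x y) m,
    submod_at y m -> submod_at x (mact f m) }.

Section SubmodModule.
Variables (M : rmod A) (P : submod M).

Definition sub_act (x y : A) (f : hom x y) (m : subspace_type (P y)) :
    subspace_type (P x) :=
  SubspaceElt (introT (subspace_predP _ _)
    (submod_act f (elimT (subspace_predP _ _) (subspace_valP m)))).

Program Definition sub_rmod : rmod A :=
  @RMod k A (fun x => subspace_type (P x)) sub_act _ _ _ _.
Next Obligation. by move=> x y m a f g; apply/val_inj; rewrite /= mact_linl. Qed.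
Next Obligation. by move=> x y f a m n; apply/val_inj; rewrite /= mact_linr. Qed.
Next Obligation. by move=> x m; apply/val_inj; rewrite /= mact1. Qed.
Next Obligation. by move=> x y z g f m; apply/val_inj; rewrite /= mactM. Qed.

End SubmodModule.

Definition semisimple (M : rmod A) : Prop :=
  forall P : submod M, exists P' : submod M,
    (forall x m, exists p p', [/\ P x p, P' x p' & m = p + p']) /\
    (forall x m, P x m -> P' x m -> m = 0).

Section Image.
Variables (M N : rmod A) (f : rmor M N).

Lemma mfun0 x : f x 0 = 0.
Proof. by have /= := mfun_lin f (x := x) (-1) 0 0; rewrite scaler0 addr0 scaleN1r addNr. Qed.

Program Definition mor_image_at (x : A) : subspace (N x) :=
  @Subspace k (N x) (fun n => exists m, f x m = n) _ _.
Next Obligation. by move=> x; exists 0; exact: mfun0. Qed.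
Next Obligation.
by move=> x a _ _ [m <-] [m' <-]; exists (a *: m + m'); rewrite mfun_lin.
Qed.

Program Definition mor_image : submod N := @Submod N mor_image_at _.
Next Obligation. by move=> x y g _ [m <-]; exists (mact g m); exact: mfun_nat. Qed.

Program Definition to_image : rmor M (sub_rmod mor_image) :=
  @RMor k A M (sub_rmod mor_image)
    (fun x m => @SubspaceElt _ _ (mor_image x) (f x m) _) _ _.
Next Obligation. by move=> x m; apply/subspace_predP; exists m. Qed.
Next Obligation. by move=> x a m n; apply/val_inj; rewrite /= mfun_lin. Qed.
Next Obligation. by move=> x y g m; apply/val_inj; rewrite /= mfun_nat. Qed.

End Image.

Program Definition mor_comp (M N P : rmod A) (g : rmor N P) (f : rmor M N) : rmor M P :=
  @RMor k A M P (fun x m => g x (f x m)) _ _.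
Next Obligation. by move=> M N P g f x a m n; rewrite /= !mfun_lin. Qed.
Next Obligation. by move=> M N P g f x y h m; rewrite /= !mfun_nat. Qed.

Program Definition dsum (M N : rmod A) : rmod A :=
  @RMod k A (fun x => (M x * N x)%type)
    (fun x y f mn => (mact f mn.1, mact f mn.2)) _ _ _ _.
Next Obligation. by move=> M N x y m a f g; congr pair; rewrite /= mact_linl. Qed.
Next Obligation. by move=> M N x y f a m n; congr pair; rewrite /= mact_linr. Qed.
Next Obligation. by move=> M N x [m n]; rewrite /= !mact1. Qed.
Next Obligation. by move=> M N x y z g f [m n]; rewrite /= !mactM. Qed.

Lemma mact0r (M : rmod A) (x y : A) (f : hom x y) : mact f (0 : M y) = 0.
Proof.
by have /= := @mact_linr _ _ M _ _ f (-1) 0 0; rewrite scaler0 addr0 scaleN1r addNr.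
Qed.

Program Definition dsum_inl (M N : rmod A) : rmor M (dsum M N) :=
  @RMor k A M (dsum M N) (fun x m => (m, 0)) _ _.
Next Obligation. by move=> M N x a m n; congr pair; rewrite /= scaler0 addr0. Qed.
Next Obligation. by move=> M N x y f m; rewrite /= mact0r. Qed.

Definition has_dim (V : lmodType k) (n : nat) : Prop :=
  exists f : 'rV[k]_n -> V, linear f /\ bijective f.

Definition has_dimvec (M : rmod A) (d : A -> nat) : Prop :=
  forall x, has_dim (M x) (d x).

(* The representable module A(-, z) *)
Program Definition representable (z : A) : rmod A :=
  @RMod k A (fun x => hom x z) (fun x y f g => hcomp g f) _ _ _ _.
Next Obligation. by move=> z x y m; apply: hcomp_linr. Qed.
Next Obligation. by move=> z x y f; apply: hcomp_linl. Qed.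
Next Obligation. by move=> z x m; apply: hcompm1. Qed.
Next Obligation. by move=> z x y t g f m; apply: hcompA. Qed.

Program Definition yoneda (M : rmod A) (z : A) (m : M z) : rmor (representable z) M :=
  @RMor k A (representable z) M (fun x f => mact f m) _ _.
Next Obligation. by move=> M z m x; apply: mact_linl. Qed.
Next Obligation. by move=> M z m x y f g; apply: mactM. Qed.

End Modules.


Section MorphismSpace.
Variables (k : fieldType) (A : lincat k) (M N : rmod A).

HB.instance Definition _ := gen_eqMixin (rmor M N).
HB.instance Definition _ := gen_choiceMixin (rmor M N).

Program Definition rmor0 : rmor M N := @RMor k A M N (fun x m => 0) _ _.
Next Obligation. by move=> x a m n; rewrite scaler0 addr0. Qed.
Next Obligation. by move=> x y f m; rewrite mact0r. Qed.

Program Definition rmorZD (a : k) (f g : rmor M N) : rmor M N :=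
  @RMor k A M N (fun x m => a *: f x m + g x m) _ _.
Next Obligation.
move=> a f g x b m n; rewrite !mfun_lin !scalerDr !scalerA (mulrC b a).
by rewrite -!addrA; congr (_ + _); rewrite addrCA.
Qed.
Next Obligation. by move=> a f g x y h m; rewrite /= !mfun_nat mact_linr. Qed.

Let rmorD (f g : rmor M N) := rmorZD 1 f g.
Let rmorN (f : rmor M N) := rmorZD (-1) f rmor0.
Let rmorZ a (f : rmor M N) := rmorZD a f rmor0.

Fact rmorDA : associative rmorD.
Proof. by move=> f g h; apply: rmorP => x m; rewrite /= !scale1r addrA. Qed.
Fact rmorDC : commutative rmorD.
Proof. by move=> f g; apply: rmorP => x m; rewrite /= !scale1r addrC. Qed.
Fact rmor0D : left_id rmor0 rmorD.
Proof. by move=> f; apply: rmorP => x m; rewrite /= scaler0 add0r. Qed.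
Fact rmorND : left_inverse rmor0 rmorN rmorD.
Proof. by move=> f; apply: rmorP => x m; rewrite /= scale1r addr0 scaleN1r addNr. Qed.
HB.instance Definition _ := GRing.isZmodule.Build (rmor M N) rmorDA rmorDC rmor0D rmorND.

Fact rmorZA a b f : rmorZ a (rmorZ b f) = rmorZ (a * b) f.
Proof. by apply: rmorP => x m; rewrite /= !addr0 scalerA. Qed.
Fact rmor1Z : left_id 1 rmorZ.
Proof. by move=> f; apply: rmorP => x m; rewrite /= addr0 scale1r. Qed.
Fact rmorZDr : right_distributive rmorZ +%R.
Proof.
by move=> a f g; apply: rmorP => x m; rewrite /= !addr0 !scale1r scalerDr.
Qed.
Fact rmorZDl f : {morph rmorZ^~ f : a b / a + b}.
Proof.
by move=> a b; apply: rmorP => x m; rewrite /= !addr0 scale1r scalerDl.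
Qed.
HB.instance Definition _ :=
  GRing.Zmodule_isLmodule.Build k (rmor M N) rmorZA rmor1Z rmorZDr rmorZDl.

Lemma rmor0E x m : (0 : rmor M N) x m = 0. Proof. by []. Qed.
Lemma rmorDE (f g : rmor M N) x m : (f + g) x m = f x m + g x m.
Proof. by rewrite -[f x m]scale1r. Qed.
Lemma rmorZE a (f : rmor M N) x m : (a *: f) x m = a *: f x m.
Proof. by rewrite -[RHS]addr0. Qed.

End MorphismSpace.

Section KanExtensions.
Variables (k : fieldType) (A : lincat k) (O : Type) (iota : O -> A).
Let S := full_sub iota.

(* An adjoint of [restr] is given by its (co)unit and its transposition maps. *)
Record left_adjoint := LeftAdjoint {
  lad_obj :> rmod S -> rmod A;
  lad_unit : forall M, rmor M (restr iota (lad_obj M));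
  lad_tr : forall M N, rmor M (restr iota N) -> rmor (lad_obj M) N;
  lad_trK : forall M N (f : rmor M (restr iota N)),
    mor_comp (restr_mor iota (lad_tr f)) (lad_unit M) = f;
  lad_uniq : forall M N (g : rmor (lad_obj M) N),
    lad_tr (mor_comp (restr_mor iota g) (lad_unit M)) = g }.

Record right_adjoint := RightAdjoint {
  rad_obj :> rmod S -> rmod A;
  rad_counit : forall M, rmor (restr iota (rad_obj M)) M;
  rad_tr : forall M N, rmor (restr iota N) M -> rmor N (rad_obj M);
  rad_trK : forall M N (f : rmor (restr iota N) M),
    mor_comp (rad_counit M) (restr_mor iota (rad_tr f)) = f;
  rad_uniq : forall M N (g : rmor N (rad_obj M)),
    rad_tr (mor_comp (rad_counit M) (restr_mor iota g)) = g }.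

Section Canonical.
Variables (KL : left_adjoint) (KR : right_adjoint) (M : rmod S).

Program Definition yoneda_res (u : O) (m : M u) :
    rmor (restr iota (representable (iota u))) M :=
  @RMor k S (restr iota (representable (iota u))) M
    (fun v f => @mact k S M v u f m) _ _.
Next Obligation. by move=> u m x; exact: (@mact_linl k S M x u m). Qed.
Next Obligation. by move=> u m x y f g; exact: (@mactM k S M x y u g f m). Qed.

Definition counit_inv (u : S) (m : M u) : KR M (iota u) :=
  rad_tr KR (yoneda_res m) (iota u) (idm (iota u)).

Lemma counit_invK u : cancel (@counit_inv u) (rad_counit KR M u).
Proof.
move=> m; have := congr1 (fun g : rmor (restr iota (representable (iota u))) M => g u (idm (iota u)))
  (rad_trK KR (yoneda_res m)).
by move=> /= ->; exact: (@mact1 k S M u).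
Qed.

Lemma counitK u : cancel (rad_counit KR M u) (@counit_inv u).
Proof.
move=> n; rewrite /counit_inv.
have -> : yoneda_res (rad_counit KR M u n) =
  mor_comp (rad_counit KR M) (restr_mor iota (@yoneda k A (KR M) (iota u) n)).
  by apply: rmorP => v f /=; rewrite -(mfun_nat (rad_counit KR M)).
by rewrite rad_uniq /= mact1.
Qed.

Program Definition counit_inv_mor : rmor M (restr iota (KR M)) :=
  @RMor k S M (restr iota (KR M)) counit_inv _ _.
Next Obligation.
move=> u a m n; apply: (can_inj (@counitK u)).
by rewrite (mfun_lin (rad_counit KR M)) !counit_invK.
Qed.
Next Obligation.
move=> u v f m; apply: (can_inj (@counitK u)).
by rewrite (mfun_nat (rad_counit KR M)) !counit_invK.
Qed.

(* The canonical morphism K_L(M) -> K_R(M): the one whose restriction is the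
   identity of M when the restrictions of K_L(M) and K_R(M) are identified
   with M through the unit and the counit. *)
Definition kan_canonical : rmor (KL M) (KR M) := lad_tr KL counit_inv_mor.

Lemma kan_canonicalP (u : S) (m : M u) :
  rad_counit KR M u (kan_canonical (iota u) (lad_unit KL M u m)) = m.
Proof.
have := congr1 (fun g : rmor M (restr iota (KR M)) => g u m)
  (lad_trK KL counit_inv_mor).
by move=> /= ->; exact: counit_invK.
Qed.

Lemma kan_canonical_uniq (c : rmor (KL M) (KR M)) :
  (forall (u : S) (m : M u),
     rad_counit KR M u (c (iota u) (lad_unit KL M u m)) = m) ->
  c = kan_canonical.
Proof.
move=> cP; rewrite -[c]lad_uniq /kan_canonical; congr (lad_tr KL _).
apply: rmorP => u m /=; apply: (can_inj (@counitK u)).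
by rewrite cP counit_invK.
Qed.

Definition K_LR : rmod A := sub_rmod (mor_image kan_canonical).

Definition K_LR_unit : rmor M (restr iota K_LR) :=
  mor_comp (restr_mor iota (to_image kan_canonical)) (lad_unit KL M).

End Canonical.

(* Both adjoints exist. *)
Section LeftKan.
Variable M : rmod S.

Definition kan_gen (x : A) : Type := {u : O & (hom x (iota u) * M u)%type}.
HB.instance Definition _ x := gen_eqMixin (kan_gen x).
HB.instance Definition _ x := gen_choiceMixin (kan_gen x).

Definition kan_pair x u (r : hom x (iota u)) (m : M u) : kan_gen x :=
  existT _ u (r, m).

Section Eval.
Variables (N : rmod A) (g : rmor M (restr iota N)).
Definition kan_eval1 x (t : kan_gen x) : N x :=
  mact (projT2 t).1 (g (projT1 t) (projT2 t).2).
Definition kan_eval x : {malg k[kan_gen x]} -> N x := lin_ext (@kan_eval1 x).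
End Eval.

Program Definition kan_rel x : subspace {malg k[kan_gen x]} :=
  @Subspace k _ (fun f => forall N g, @kan_eval N g x f = 0) _ _.
Next Obligation. by move=> x N g; rewrite /kan_eval /lin_ext msupp0 big_seq_fset0. Qed.
Next Obligation.
move=> x a f f' f0 f'0 N g.
by rewrite /kan_eval lin_ext_linear -!/(kan_eval _ _) f0 f'0 scaler0 addr0.
Qed.

Definition kan_ev (N : rmod A) (g : rmor M (restr iota N)) x (q : quot_space (kan_rel x)) : N x :=
  kan_eval g (qrepr q).

Lemma kan_ev_pi N (g : rmor M (restr iota N)) x w : kan_ev g (qpi (kan_rel x) w) = kan_eval g w.
Proof.
apply/eqP; rewrite -subr_eq0; apply/eqP.
have := @qrepr_pi _ _ (kan_rel x) w N g.
rewrite addrC -scaleN1r {1}/kan_eval lin_ext_linear scaleN1r addrC; exact.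
Qed.

Lemma kan_ev_lin N (g : rmor M (restr iota N)) x : linear (@kan_ev N g x).
Proof.
move=> a p q; rewrite -[p]qreprK -[q]qreprK -qpi_linear !kan_ev_pi.
exact: lin_ext_linear.
Qed.

Lemma kan_ext x (p q : quot_space (kan_rel x)) :
  (forall N g, @kan_ev N g x p = kan_ev g q) -> p = q.
Proof.
move=> pq; rewrite -[p]qreprK -[q]qreprK; apply/qpiP => N g.
by rewrite addrC -scaleN1r /kan_eval lin_ext_linear scaleN1r addrC
  -!/(kan_eval _ _) -!/(kan_ev _ _) pq subrr.
Qed.

Definition kan_push x y (f : hom x y) (w : {malg k[kan_gen y]}) : {malg k[kan_gen x]} :=
  lin_ext (fun t : kan_gen y => << kan_pair (hcomp (projT2 t).1 f) (projT2 t).2 >>) w.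

Lemma kan_eval_push N (g : rmor M (restr iota N)) x y (f : hom x y) w :
  kan_eval g (kan_push f w) = mact f (kan_eval g w).
Proof.
rewrite /kan_push /kan_eval {2 3}/lin_ext.
elim/big_rec2: _ => [|t v w' _ IH]; last first.
  by rewrite lin_ext_linear lin_extU [RHS]mact_linr IH /kan_eval1 /= mactM.
by rewrite mact0r /lin_ext msupp0 big_seq_fset0.
Qed.

Definition kan_act x y (f : hom x y) (q : quot_space (kan_rel y)) : quot_space (kan_rel x) :=
  qpi _ (kan_push f (qrepr q)).

Lemma kan_ev_act N (g : rmor M (restr iota N)) x y (f : hom x y) q :
  kan_ev g (kan_act f q) = mact f (kan_ev g q).
Proof. by rewrite kan_ev_pi kan_eval_push. Qed.

Program Definition kan_left : rmod A :=
  @RMod k A (fun x => quot_space (kan_rel x)) kan_act _ _ _ _.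
Next Obligation.
move=> x y m a f g; apply: kan_ext => N h.
by rewrite kan_ev_lin !kan_ev_act mact_linl.
Qed.
Next Obligation.
move=> x y f a m n; apply: kan_ext => N h.
by rewrite kan_ev_lin !kan_ev_act kan_ev_lin mact_linr.
Qed.
Next Obligation. by move=> x m; apply: kan_ext => N h; rewrite kan_ev_act mact1. Qed.
Next Obligation.
by move=> x y z g f m; apply: kan_ext => N h; rewrite !kan_ev_act mactM.
Qed.

Definition kan_unit (u : O) (m : M u) : kan_left (iota u) :=
  qpi _ << kan_pair (idm (iota u)) m >>.

Lemma kan_ev_unit N (g : rmor M (restr iota N)) u m : kan_ev g (kan_unit m) = g u m.
Proof. by rewrite kan_ev_pi /kan_eval lin_extU /kan_eval1 /= mact1. Qed.

Program Definition kan_unit_mor : rmor M (restr iota kan_left) :=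
  @RMor k S M (restr iota kan_left) kan_unit _ _.
Next Obligation.
move=> u a m n; apply: kan_ext => N h.
by rewrite kan_ev_lin !kan_ev_unit mfun_lin.
Qed.
Next Obligation.
move=> u v f m; apply: kan_ext => N h.
by rewrite /= kan_ev_act !kan_ev_unit mfun_nat.
Qed.

Program Definition kan_tr N (g : rmor M (restr iota N)) : rmor kan_left N :=
  @RMor k A kan_left N (kan_ev g) _ _.
Next Obligation. by move=> N g x; exact: kan_ev_lin. Qed.
Next Obligation. by move=> N g x y f m; exact: kan_ev_act. Qed.

Lemma kan_trK N (g : rmor M (restr iota N)) :
  mor_comp (restr_mor iota (kan_tr g)) kan_unit_mor = g.
Proof. by apply: rmorP => u m; exact: kan_ev_unit. Qed.

Lemma kan_uniq N (g : rmor kan_left N) :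
  kan_tr (mor_comp (restr_mor iota g) kan_unit_mor) = g.
Proof.
apply: rmorP => x q; rewrite -[q]qreprK /= kan_ev_pi.
set w := qrepr q; rewrite [in RHS](monalgE w) /kan_eval /lin_ext.
elim/big_rec2: _ => [|t v w' _ ->].
  rewrite -[qpi _ 0]/(qpi _ (0 : {malg k[kan_gen x]})).
  have -> : qpi (kan_rel x) 0 = 0 by have := qpi_linear (kan_rel x) (-1) 0 0;
    rewrite scaler0 addr0 scaleN1r addNr.
  by rewrite mfun0.
have -> : << w@_t *g t >> = w@_t *: << t >> :> {malg k[kan_gen x]}.
  by apply/malgP => t'; rewrite mcoeffZ !mcoeffU mulrnAr mulr1.
rewrite qpi_linear mfun_lin; congr (_ *: _ + _).
rewrite /kan_eval1 /= -mfun_nat; congr (g x _); apply: kan_ext => P h.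
rewrite kan_ev_act kan_ev_unit kan_ev_pi /kan_eval lin_extU //.
Qed.

End LeftKan.

Definition left_kan : left_adjoint :=
  @LeftAdjoint kan_left kan_unit_mor kan_tr kan_trK kan_uniq.

Section RightKan.
Variable M : rmod S.

(* K_R(M)(x) = Hom_S(A(-, x)|_S, M) *)
Definition kan_right_at (x : A) : lmodType k := rmor (restr iota (representable x)) M.

Program Definition kan_pre x y (f : hom x y) (phi : kan_right_at y) : kan_right_at x :=
  @RMor k S (restr iota (representable x)) M
    (fun v g => (phi : rmor _ _) v (hcomp f g)) _ _.
Next Obligation.
by move=> x y f phi v a g h; rewrite hcomp_linr; exact: (mfun_lin phi).
Qed.
Next Obligation.
move=> x y f phi u v h g; rewrite -(mfun_nat (phi : rmor _ _)) /=.
by congr (mfun _ _); exact: hcompA.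
Qed.

Program Definition kan_right : rmod A :=
  @RMod k A kan_right_at kan_pre _ _ _ _.
Next Obligation.
move=> x y phi a f g; apply: rmorP => v h.
by rewrite rmorDE rmorZE /= hcomp_linl; exact: (mfun_lin phi).
Qed.
Next Obligation.
move=> x y f a phi psi; apply: rmorP => v h.
rewrite [RHS]rmorDE [X in _ = X + _]rmorZE.
apply: etrans (rmorDE (a *: (phi : rmor _ _)) psi (hcomp f h)) _.
by rewrite rmorZE.
Qed.
Next Obligation. by move=> x phi; apply: rmorP => v h; rewrite /= hcomp1m. Qed.
Next Obligation. by move=> x y z g f phi; apply: rmorP => v h; rewrite /= hcompA. Qed.

Program Definition kan_counit : rmor (restr iota kan_right) M :=
  @RMor k S (restr iota kan_right) M (fun u phi => (phi : rmor _ _) u (idm (iota u))) _ _.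
Next Obligation. by move=> u a phi psi; rewrite rmorDE rmorZE. Qed.
Next Obligation.
move=> u v f phi; rewrite -(mfun_nat (phi : rmor _ _)) /=.
by congr (mfun _ _); rewrite hcompm1; exact/esym/hcomp1m.
Qed.

Program Definition kan_cotr1 N (f : rmor (restr iota N) M) x (n : N x) : kan_right_at x :=
  @RMor k S (restr iota (representable x)) M (fun v g => f v (mact g n)) _ _.
Next Obligation. by move=> N f x n v a g h; rewrite mact_linl mfun_lin. Qed.
Next Obligation. by move=> N f x n u v h g; rewrite -mfun_nat /= mactM. Qed.

Program Definition kan_cotr N (f : rmor (restr iota N) M) : rmor N kan_right :=
  @RMor k A N kan_right (kan_cotr1 f) _ _.
Next Obligation.
move=> N f x a m n; apply: rmorP => v g.
by rewrite rmorDE rmorZE /= mact_linr (mfun_lin f).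
Qed.
Next Obligation. by move=> N f x y g n; apply: rmorP => v h; rewrite /= mactM. Qed.

Lemma kan_cotrK N (f : rmor (restr iota N) M) :
  mor_comp kan_counit (restr_mor iota (kan_cotr f)) = f.
Proof. by apply: rmorP => u n; rewrite /= mact1. Qed.

Lemma kan_couniq N (g : rmor N kan_right) :
  kan_cotr (mor_comp kan_counit (restr_mor iota g)) = g.
Proof.
apply: rmorP => x n; apply: rmorP => v h /=.
by rewrite (mfun_nat g) /= hcompm1.
Qed.

End RightKan.

Definition right_kan : right_adjoint :=
  @RightAdjoint kan_right kan_counit kan_cotr kan_cotrK kan_couniq.

End KanExtensions.

Section Paths.
Variables (V : Type) (E : V -> V -> Type).

Inductive qpath : V -> V -> Type :=
| Pnil x : qpath x x
| Pcons x y z of E x y & qpath y z : qpath x z.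

Fixpoint catp x y z (p : qpath x y) : qpath y z -> qpath x z :=
  match p with
  | Pnil _ => id
  | Pcons _ _ _ a p' => fun q => Pcons a (catp p' q)
  end.

Fixpoint path_length x y (p : qpath x y) : nat :=
  if p is Pcons _ _ _ _ p' then (path_length p').+1 else 0%N.

Definition path1 x y (a : E x y) : qpath x y := Pcons a (Pnil y).
Definition path2 x y z (a : E x y) (b : E y z) : qpath x z := Pcons a (path1 b).

Lemma catp_nil x y (p : qpath x y) : catp p (Pnil y) = p.
Proof. by elim: p => //= ? ? ? a p ->. Qed.

Lemma catpA x y z t (p : qpath x y) (q : qpath y z) (r : qpath z t) :
  catp p (catp q r) = catp (catp p q) r.
Proof. by elim: p q => //= ? ? ? a p IH q; rewrite IH. Qed.

HB.instance Definition _ x y := gen_eqMixin (qpath x y).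
HB.instance Definition _ x y := gen_choiceMixin (qpath x y).
End Paths.

Section PresentedCategories.
Variables (k : fieldType) (V : Type) (E : V -> V -> Type).

Local Notation lpath x y := {malg k[qpath E x y]}.

Definition lcomp x y z (g : lpath y z) (f : lpath x y) : lpath x z :=
  lin_ext (fun q => lin_ext (fun p => << catp p q >> : lpath x z) f) g.

Variable rel : forall x y, lpath x y -> Prop.

(* The two-sided ideal of the path category generated by the relators *)
Inductive gen_ideal : forall x y, lpath x y -> Prop :=
| ideal_gen x y (f : lpath x y) of rel f : gen_ideal f
| ideal_0 x y : gen_ideal (0 : lpath x y)
| ideal_lin x y a (f g : lpath x y) of gen_ideal f & gen_ideal g : gen_ideal (a *: f + g)
| ideal_compl x y z (g : lpath y z) (f : lpath x y) of gen_ideal f : gen_ideal (lcomp g f)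
| ideal_compr x y z (g : lpath y z) (f : lpath x y) of gen_ideal g : gen_ideal (lcomp g f).

Definition ideal_sub x y : subspace (lpath x y) :=
  Subspace (ideal_0 x y) (@ideal_lin x y).

Lemma lin_ext_addh (K : choiceType) (W : lmodType k) (h h' : K -> W) a f :
  lin_ext (fun p => a *: h p + h' p) f = a *: lin_ext h f + lin_ext h' f.
Proof.
rewrite /lin_ext scaler_sumr -big_split; apply: eq_bigr => p _ /=.
by rewrite scalerDr !scalerA mulrC.
Qed.

Lemma lcomp_linl x y z (f : lpath x y) : linear (fun g : lpath y z => lcomp g f).
Proof. exact: lin_ext_linear. Qed.

Lemma lcomp_linr x y z (g : lpath y z) : linear (fun f : lpath x y => lcomp g f).
Proof.
move=> a f f'; rewrite /lcomp -lin_ext_addh; apply: eq_bigr => q _.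
by rewrite lin_ext_linear.
Qed.

Lemma lin_ext_comp (K : choiceType) (W W' : lmodType k) (h : K -> W) (l : W -> W') f :
  linear l -> l (lin_ext h f) = lin_ext (l \o h) f.
Proof.
move=> ll; have l0 : l 0 = 0.
  by have := ll (-1) 0 0; rewrite scaler0 addr0 scaleN1r addNr.
rewrite /lin_ext; elim/big_rec2: _ => // p u v _ <-; exact: ll.
Qed.

Lemma lin_ext_id (K : choiceType) (f : {malg k[K]}) : lin_ext (fun p => << p >>) f = f.
Proof.
rewrite [RHS]monalgE /lin_ext; apply: eq_bigr => p _.
by apply/malgP => q; rewrite mcoeffZ !mcoeffU mulrnAr mulr1.
Qed.

Lemma lcompU x y z (q : qpath E y z) (p : qpath E x y) :
  lcomp << q >> << p >> = << catp p q >>.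
Proof. by rewrite /lcomp !lin_extU. Qed.

Lemma lcomp1m x y (f : lpath x y) : lcomp << Pnil E y >> f = f.
Proof.
rewrite /lcomp lin_extU -[RHS]lin_ext_id; apply: eq_bigr => p _.
by rewrite catp_nil.
Qed.

Lemma lcompm1 x y (f : lpath x y) : lcomp f << Pnil E x >> = f.
Proof.
by rewrite /lcomp -[RHS]lin_ext_id; apply: eq_bigr => p _; rewrite lin_extU.
Qed.

Lemma lcompA x y z t (h : lpath z t) (g : lpath y z) (f : lpath x y) :
  lcomp h (lcomp g f) = lcomp (lcomp h g) f.
Proof.
rewrite -[in LHS](lin_ext_id h) -[in RHS](lin_ext_id h).
have lA : linear (fun h : lpath z t => lcomp h (lcomp g f)) by exact: lcomp_linl.
have lB : linear (fun h : lpath z t => lcomp (lcomp h g) f).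
  by move=> a h1 h2 /=; rewrite !lcomp_linl.
rewrite (lin_ext_comp _ _ lA) (lin_ext_comp _ _ lB); apply: eq_bigr => r _ /=.
congr (_ *: _).
rewrite -[in LHS](lin_ext_id g) -[in RHS](lin_ext_id g).
have {}lA : linear (fun g : lpath y z => lcomp << r >> (lcomp g f)).
  by move=> a h1 h2 /=; rewrite lcomp_linl lcomp_linr.
have {}lB : linear (fun g : lpath y z => lcomp (lcomp << r >> g) f).
  by move=> a h1 h2 /=; rewrite lcomp_linr lcomp_linl.
rewrite (lin_ext_comp _ _ lA) (lin_ext_comp _ _ lB); apply: eq_bigr => q _ /=.
congr (_ *: _).
rewrite -[in LHS](lin_ext_id f) -[in RHS](lin_ext_id f).
have {}lA : linear (fun f : lpath x y => lcomp << r >> (lcomp << q >> f)).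
  by move=> a h1 h2 /=; rewrite !lcomp_linr.
have {}lB : linear (fun f : lpath x y => lcomp (lcomp << r >> << q >>) f).
  by move=> a h1 h2 /=; rewrite lcomp_linr.
rewrite (lin_ext_comp _ _ lA) (lin_ext_comp _ _ lB); apply: eq_bigr => p _ /=.
by rewrite !lcompU catpA.
Qed.

Definition pres_hom x y : lmodType k := quot_space (ideal_sub x y).
Definition pres_comp x y z (g : pres_hom y z) (f : pres_hom x y) : pres_hom x z :=
  qpi _ (lcomp (qrepr g) (qrepr f)).

Lemma lcompBl x y z (g g' : lpath y z) (f : lpath x y) :
  lcomp (g - g') f = lcomp g f - lcomp g' f.
Proof. by rewrite addrC -scaleN1r lcomp_linl scaleN1r addrC. Qed.

Lemma lcompBr x y z (g : lpath y z) (f f' : lpath x y) :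
  lcomp g (f - f') = lcomp g f - lcomp g f'.
Proof. by rewrite addrC -scaleN1r lcomp_linr scaleN1r addrC. Qed.

Lemma pres_comp_pi x y z (g : lpath y z) (f : lpath x y) :
  pres_comp (qpi (ideal_sub y z) g) (qpi (ideal_sub x y) f) = qpi (ideal_sub x z) (lcomp g f).
Proof.
apply/qpiP.
set g' := qrepr _; set f' := qrepr _.
rewrite -[_ - _](subrKA (lcomp g f')) -lcompBl -lcompBr.
rewrite -[X in ideal_sub _ _ (X + _)]scale1r; apply: subspaceL.
  by apply: ideal_compr; exact: (qrepr_pi (ideal_sub y z)).
by apply: ideal_compl; exact: (qrepr_pi (ideal_sub x y)).
Qed.

Program Definition presented : lincat k :=
  @LinCat k V pres_hom (fun x => qpi _ << Pnil E x >>) pres_comp _ _ _ _ _.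
Next Obligation.
move=> x y z f a g g'; rewrite -[f]qreprK -[g]qreprK -[g']qreprK -qpi_linear.
by rewrite !pres_comp_pi -qpi_linear lcomp_linl.
Qed.
Next Obligation.
move=> x y z g a f f'; rewrite -[f]qreprK -[g]qreprK -[f']qreprK -qpi_linear.
by rewrite !pres_comp_pi -qpi_linear lcomp_linr.
Qed.
Next Obligation. by move=> x y f; rewrite -[f]qreprK pres_comp_pi lcomp1m. Qed.
Next Obligation. by move=> x y f; rewrite -[f]qreprK pres_comp_pi lcompm1. Qed.
Next Obligation.
move=> x y z t h g f; rewrite -[f]qreprK -[g]qreprK -[h]qreprK.
by rewrite !pres_comp_pi lcompA.
Qed.

Definition pres_arrow x y (a : E x y) : hom (x : presented) y := qpi _ << path1 a >>.

(* A family of spaces and linear maps indexed by the vertices and the arrows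
   (contravariantly) which satisfies the relations extends to a module. *)
Section ModuleOfRepresentation.
Variables (N : V -> lmodType k) (Nact : forall x y, E x y -> N y -> N x).

Fixpoint path_act x y (p : qpath E x y) : N y -> N x :=
  match p with
  | Pnil _ => id
  | Pcons _ _ _ a p' => fun m => Nact a (path_act p' m)
  end.

Definition lpath_act x y (f : lpath x y) (m : N y) : N x :=
  lin_ext (fun p => path_act p m) f.

Hypothesis Nact_lin : forall x y (a : E x y), linear (Nact a).
Hypothesis Nact_rel : forall x y (f : lpath x y), rel f -> forall m, lpath_act f m = 0.

Lemma path_act_lin x y (p : qpath E x y) : linear (path_act p).
Proof. by elim: p => //= ? ? ? a p IH b m n; rewrite IH Nact_lin. Qed.

Lemma lpath_act_linl x y (m : N y) : linear (fun f : lpath x y => lpath_act f m).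
Proof. exact: lin_ext_linear. Qed.

Lemma lpath_act_linr x y (f : lpath x y) : linear (lpath_act f).
Proof.
move=> a m n; rewrite /lpath_act -lin_ext_addh; apply: eq_bigr => p _.
by rewrite path_act_lin.
Qed.

Lemma path_act_cat x y z (p : qpath E x y) (q : qpath E y z) m :
  path_act (catp p q) m = path_act p (path_act q m).
Proof. by elim: p q m => //= ? ? ? a p IH q m; rewrite IH. Qed.

Lemma lpath_act_comp x y z (g : lpath y z) (f : lpath x y) m :
  lpath_act (lcomp g f) m = lpath_act f (lpath_act g m).
Proof.
rewrite /lcomp (lin_ext_comp _ _ (@lpath_act_linl _ _ m)).
rewrite [X in lpath_act f X]/lpath_act (lin_ext_comp _ _ (lpath_act_linr f)).
apply: eq_bigr => q _ /=; congr (_ *: _).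
rewrite (lin_ext_comp _ _ (@lpath_act_linl _ _ m)); apply: eq_bigr => p _ /=.
by rewrite /lpath_act lin_extU path_act_cat.
Qed.

Lemma lpath_act0r x y (f : lpath x y) : lpath_act f 0 = 0.
Proof. by have := lpath_act_linr f (-1) 0 0; rewrite scaler0 addr0 scaleN1r addNr. Qed.

Lemma lpath_act_ideal x y (f : lpath x y) : gen_ideal f -> forall m, lpath_act f m = 0.
Proof.
elim=> {x y f} [x y f rf|x y|x y a f g _ If _ Ig|x y z g f _ If|x y z g f _ Ig] m.
- exact: Nact_rel.
- by rewrite /lpath_act /lin_ext msupp0 big_seq_fset0.
- by rewrite lpath_act_linl If Ig scaler0 addr0.
- by rewrite lpath_act_comp If.
- by rewrite lpath_act_comp Ig lpath_act0r.
Qed.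

Definition pres_act x y (f : pres_hom x y) (m : N y) : N x := lpath_act (qrepr f) m.

Lemma pres_act_pi x y (f : lpath x y) m :
  pres_act (qpi (ideal_sub x y) f) m = lpath_act f m.
Proof.
apply/eqP; rewrite -subr_eq0; apply/eqP.
have /(_ m) := lpath_act_ideal (qrepr_pi (ideal_sub x y) f).
by rewrite addrC -scaleN1r lpath_act_linl scaleN1r addrC.
Qed.

Program Definition rmod_of_rep : rmod presented :=
  @RMod k presented N pres_act _ _ _ _.
Next Obligation.
move=> x y m a f g; rewrite -[f]qreprK -[g]qreprK -qpi_linear !pres_act_pi.
exact: lpath_act_linl.
Qed.
Next Obligation. by move=> x y f; exact: lpath_act_linr. Qed.
Next Obligation. by move=> x m; rewrite pres_act_pi /lpath_act lin_extU. Qed.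
Next Obligation.
move=> x y z g f m; rewrite -[f]qreprK -[g]qreprK /= pres_comp_pi !pres_act_pi.
exact: lpath_act_comp.
Qed.

End ModuleOfRepresentation.

Lemma mact_path (M : rmod presented) x y (p : qpath E x y) (m : M y) :
  mact (qpi (ideal_sub x y) << p >> : hom (x : presented) y) m =
  path_act (fun x y a => @mact _ _ M x y (pres_arrow a)) p m.
Proof.
elim: p m => [z|x' y' z a p IH] m /=; first exact: (@mact1 _ _ M).
rewrite -IH -mactM /=; congr mact.
by rewrite pres_comp_pi lcompU.
Qed.

Lemma mact_lpath (M : rmod presented) x y (f : lpath x y) (m : M y) :
  mact (qpi (ideal_sub x y) f : hom (x : presented) y) m =
  lpath_act (fun x y a => @mact _ _ M x y (pres_arrow a)) f m.
Proof.
rewrite -[in LHS](lin_ext_id f).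
have l : linear (fun f : lpath x y =>
    @mact _ _ M x y (qpi (ideal_sub x y) f : hom (x : presented) y) m).
  by move=> a g h; rewrite qpi_linear; exact: mact_linl.
by rewrite (lin_ext_comp _ _ l); apply: eq_bigr => p _ /=; rewrite mact_path.
Qed.

Lemma mact_rel (M : rmod presented) x y (f : lpath x y) (m : M y) :
  rel f -> lpath_act (fun x y a => @mact _ _ M x y (pres_arrow a)) f m = 0.
Proof.
move=> /ideal_gen fI; rewrite -mact_lpath.
have -> : qpi (ideal_sub x y) f = 0.
  have <- : qpi (ideal_sub x y) 0 = 0.
    by have := qpi_linear (ideal_sub x y) (-1) 0 0;
      rewrite scaler0 addr0 scaleN1r addNr.
  by apply/qpiP; rewrite subr0.
have /= := @mact_linl _ _ M x y m (-1) 0 0.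
by rewrite scaler0 addr0 scaleN1r addNr.
Qed.

End PresentedCategories.

Record finquiver := FinQuiver {
  qvert :> finType;
  qarr : qvert -> qvert -> finType }.

Definition acyclic (Q : finquiver) : Prop :=
  forall (i : Q) (p : qpath (@qarr Q) i i), path_length p = 0%N.

Section Repetition.
Variables (k : fieldType) (Q : finquiver).

Definition zvert : Type := (Q * int)%type.

(* [ZArr] is (alpha, p), from (i, p) to (j, p), and [ZSigma] is
   sigma(alpha, p), from (j, p - 1) to (i, p), for alpha from i to j. *)
Inductive zarr (x y : zvert) : Type :=
| ZArr (a : qarr x.1 y.1) of x.2 = y.2
| ZSigma (a : qarr y.1 x.1) of x.2 = y.2 - 1.

Definition tau (x : zvert) : zvert := (x.1, x.2 - 1).

Definition sigma (y x : zvert) (b : zarr y x) : zarr (tau x) y :=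
  match b with
  | ZArr a e => @ZSigma (tau x) y a (congr1 (fun p => p - 1) (esym e))
  | ZSigma a e => @ZArr (tau x) y a (esym e)
  end.

Local Notation lpath x y := {malg k[qpath zarr x y]}.

Definition mesh_path (y x : zvert) (b : zarr y x) : lpath (tau x) x :=
  << path2 (sigma b) b >>.

(* The arrows ending at x = (i, p) are the (alpha, p) : (j, p) -> (i, p) for
   alpha : j -> i and the sigma(alpha, p) : (j, p - 1) -> (i, p) for
   alpha : i -> j. *)
Definition mesh_relator (x : zvert) : lpath (tau x) x :=
  \sum_(j : Q) \sum_(a : qarr j x.1) mesh_path (@ZArr (j, x.2) x a erefl) +
  \sum_(j : Q) \sum_(a : qarr x.1 j) mesh_path (@ZSigma (j, x.2 - 1) x a erefl).

Lemma lpath_act_mesh (N : zvert -> lmodType k)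
    (Nact : forall x y, zarr x y -> N y -> N x) x (m : N x) :
  lpath_act Nact (mesh_relator x) m =
  \sum_(j : Q) \sum_(a : qarr j x.1)
    Nact _ _ (sigma (@ZArr (j, x.2) x a erefl)) (Nact _ _ (@ZArr (j, x.2) x a erefl) m) +
  \sum_(j : Q) \sum_(a : qarr x.1 j)
    Nact _ _ (sigma (@ZSigma (j, x.2 - 1) x a erefl))
      (Nact _ _ (@ZSigma (j, x.2 - 1) x a erefl) m).
Proof.
pose l (f : lpath (tau x) x) := lpath_act Nact f m.
have lD f g : l (f + g) = l f + l g.
  by rewrite -[f in LHS]scale1r /l lpath_act_linl scale1r.
have l0 : l 0 = 0 by rewrite /l /lpath_act /lin_ext msupp0 big_seq_fset0.
rewrite -/(l _) lD !(big_morph l lD l0).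
congr (_ + _); apply: eq_bigr => j _; rewrite (big_morph l lD l0);
  by apply: eq_bigr => a _; rewrite /l /lpath_act lin_extU.
Qed.

Inductive mesh_rel (P : pred zvert) : forall x y, lpath x y -> Prop :=
| MeshRel x of P x : mesh_rel P (mesh_relator x).

(* The path category of ZQ modulo the mesh relators at the vertices in P *)
Definition partial_mesh_category (P : pred zvert) : lincat k :=
  presented (@mesh_rel P).

Definition mesh_category : lincat k := partial_mesh_category xpredT.

End Repetition.

(* 'I_(i == j) consists of the single arrow i -> i' when i = j, and is empty
   otherwise. *)
Definition framed_arr (Q : finquiver) (x y : Q + Q) : finType :=
  match x, y with
  | inl i, inl j => qarr i j
  | inl i, inr j => 'I_(i == j)
  | inr _, _ => void
  end.

Definition framed (Q : finquiver) : finquiver :=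
  FinQuiver (@framed_arr Q).

Local Open Scope classical_set_scope.

Section Nakajima.
Variables (k : fieldType) (Q : finquiver).

Definition nf (x : zvert Q) : zvert (framed Q) := (inl x.1, x.2).
Definition fz (x : zvert Q) : zvert (framed Q) := (inr x.1, x.2).

Definition nonfrozen : pred (zvert (framed Q)) := fun x => is_inl x.1.

Definition nakR : lincat k := partial_mesh_category k nonfrozen.
Definition frozen_in : zvert Q -> nakR := fz.
Definition nakS : lincat k := full_sub frozen_in.

Section Inflation.
Variable S : rmod (mesh_category k Q).

Definition infl_obj (x : zvert (framed Q)) : lmodType k :=
  match x with
  | (inl i, p) => S (i, p)
  | (inr _, _) => 'rV[k]_0
  end.

Definition infl_act (x y : zvert (framed Q)) : zarr x y -> infl_obj y -> infl_obj x :=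
  match x, y with
  | (inl i, p), (inl j, q) => fun b =>
      @mact _ _ S (i, p) (j, q) (pres_arrow _
        match b with
        | ZArr a e => @ZArr Q (i, p) (j, q) a e
        | ZSigma a e => @ZSigma Q (i, p) (j, q) a e
        end)
  | _, _ => fun _ _ => 0
  end.

Lemma infl_act_lin x y (b : zarr x y) : linear (infl_act b).
Proof.
case: x y b => [[i|i] p] [[j|j] q] b a m n /=; first exact: mact_linr.
- by rewrite scaler0 addr0.
- by rewrite scaler0 addr0.
- by rewrite scaler0 addr0.
Qed.

Lemma infl_rel x y (f : {malg k[qpath (@zarr (framed Q)) x y]}) :
  mesh_rel nonfrozen f -> forall m, lpath_act (@infl_act) f m = 0.
Proof.
case=> -[[i|//] p] _ m; rewrite lpath_act_mesh !big_sumType /=.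
rewrite [X in (_ + X) + _]big1 ?addr0; last by move=> j _; rewrite big1.
rewrite [X in _ + (_ + X)]big1 ?addr0; last by move=> j _; rewrite big1.
have := @mact_rel _ _ _ (@mesh_rel k Q xpredT) S _ _ _ m (@MeshRel k Q xpredT (i, p) isT).
by rewrite lpath_act_mesh.
Qed.

(* The R-module vanishing on the frozen vertices defined by a k(ZQ)-module *)
Definition inflation : rmod nakR := rmod_of_rep infl_act_lin infl_rel.

End Inflation.

Section Representations.
Variable d : zvert (framed Q) -> nat.

Definition matrix_act (A : forall x y, zarr x y -> 'M[k]_(d y, d x))
  x y (b : zarr x y) (m : 'rV[k]_(d y)) : 'rV[k]_(d x) := m *m A x y b.

(* A point gives for each arrow b : x -> y the matrix, acting on row vectors,
   of the linear map k^(d y) -> k^(d x) by which b acts. *)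
Record rep := Rep {
  rmat :> forall x y, zarr x y -> 'M[k]_(d y, d x);
  rmat_rel : forall x y (f : {malg k[qpath (@zarr (framed Q)) x y]}),
    mesh_rel nonfrozen f -> forall m, lpath_act (matrix_act rmat) f m = 0 }.

Lemma matrix_act_lin A x y (b : zarr x y) : linear (matrix_act A b).
Proof. by move=> a m n; rewrite /matrix_act mulmxDl scalemxAl. Qed.

Definition rep_rmod (M : rep) : rmod nakR :=
  rmod_of_rep (matrix_act_lin M) (@rmat_rel M).

(* Regular functions on [rep], the polynomials in the matrix entries; [rep] is an
   affine variety when d has finite support, as almost all matrices are then
   empty. The Zariski closure is taken inside [rep]. *)
Inductive regular_fun : (rep -> k) -> Prop :=
| regular_fun_const c : regular_fun (fun _ => c)
| regular_fun_coord x y (b : zarr x y) i j : regular_fun (fun M => M x y b i j)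
| regular_fun_add f g of regular_fun f & regular_fun g : regular_fun (fun M => f M + g M)
| regular_fun_mul f g of regular_fun f & regular_fun g : regular_fun (fun M => f M * g M).

Definition zariski_closed (Z : set rep) : Prop :=
  exists2 I : set (rep -> k), I `<=` regular_fun & Z = [set M | forall f, I f -> f M = 0].

Definition zariski_closure (Z : set rep) : set rep := smallest zariski_closed Z.

End Representations.

Lemma zero_rep_rel (d : zvert (framed Q) -> nat) x y
    (f : {malg k[qpath (@zarr (framed Q)) x y]}) :
  mesh_rel nonfrozen f ->
  forall m, lpath_act (matrix_act (fun x y _ => 0 : 'M[k]_(d y, d x))) f m = 0.
Proof.
case=> z _ m; rewrite lpath_act_mesh /matrix_act.
by rewrite !big1 ?addr0 // => j _; rewrite big1 // => a _; rewrite mulmx0.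
Qed.

Definition simple_at (x : zvert (framed Q)) : rmod nakR :=
  rep_rmod (Rep (@zero_rep_rel (fun y => y == x))).

Definition stable (M : rmod nakR) : Prop :=
  forall (x : zvert Q) (f : rmor (simple_at (nf x)) M), f = 0.

Section GradedQuiverVariety.
Variables v w : {fsfun zvert Q -> nat with 0%N}.

Definition dimvec (x : zvert (framed Q)) : nat :=
  match x with (inl i, p) => v (i, p) | (inr i, p) => w (i, p) end.

(* Elements of G_v are families of invertible matrices on the non frozen
   vertices, extended by the identity on the frozen ones. *)
Definition gl_ext (g : forall x : zvert Q, 'M[k]_(v x)) (x : zvert (framed Q)) :
    'M[k]_(dimvec x) :=
  match x with (inl i, p) => g (i, p) | (inr i, p) => 1%:M end.

Definition gorbit (L : rep dimvec) : set (rep dimvec) :=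
  [set M : rep dimvec | exists2 g : forall x : zvert Q, 'M[k]_(v x),
     forall x, g x \in unitmx &
     forall x y (b : zarr x y),
       M x y b = gl_ext g y *m L x y b *m invmx (gl_ext g x)].

Definition stable_points : set (rep dimvec) := [set M | stable (rep_rmod M)].

Definition graded_quiver_variety : set (set (rep dimvec)) := gorbit @` stable_points.

(* The orbit of the points isomorphic to a module N whose restriction to S is
   identified with that of the point L through psi: as G_v acts trivially on the
   frozen part, the isomorphisms have to be compatible with psi. *)
Definition orbit_of (L : rep dimvec) (N : rmod nakR)
    (psi : rmor (restr frozen_in (rep_rmod L)) (restr frozen_in N)) :
    set (rep dimvec) :=
  [set M : rep dimvec | exists2 f : rmor (rep_rmod M) N, is_iso f &
     forall (u : zvert Q) (m : 'rV[k]_(dimvec (fz u))), f (fz u) m = psi u m].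

Definition closed_orbit_in (Z O : set (rep dimvec)) : Prop :=
  [/\ exists M, O = gorbit M, zariski_closed O & O `<=` Z].

End GradedQuiverVariety.
End Nakajima.

Arguments graded_quiver_variety k {Q} v w _.

(* Main.v *)
Require Import Defs.
From HB Require Import structures.
From mathcomp Require Import all_boot all_order all_algebra finmap.
From mathcomp Require Import boolp classical_sets reals complex.
From mathcomp Require Import monalg zify.

Set Implicit Arguments.
Unset Strict Implicit.
Unset Printing Implicit Defensive.

Import GRing.Theory.
Local Open Scope ring_scope.
Local Open Scope classical_set_scope.

(** Write E y M b E x for the compression of a point M by projectors E x, for an
    arrow b from x to y; vectors are rows, so that b maps the space at y to that
    at x. The proof chooses projectors adapted to the frozen vertices for which
    the compression is at once the limit of a one-parameter subgroup and a normal
    form for the closed orbit.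

    At a vertex x, pair the paths from x to frozen vertices with the paths from
    frozen vertices to x by composing them. The pairing has values in the
    restriction to the frozen vertices, hence is the same at all points M of the
    fibre, that is, with the restriction of L. Choose finitely many rows Q and
    columns P with T = Q P invertible of maximal size (dual_pair_exists). Then
    E = P T^-1 Q is an idempotent, polynomial in the entries of M (proj_mx). Its
    image complements, inside the submodule generated by the frozen vertices, the
    intersection of this submodule with the radical, the largest submodule
    vanishing at the frozen vertices. So the image of E represents the
    intermediate extension (has_dim_KLR), whose dimension is the rank of the
    pairing.

    The equations E y M b = M b = M b E x cut out a closed subset of the fibre
    (split_locus_closed). It is a single orbit (split_locus_base_change): on the
    images of the projectors its points are determined by the pairing, and on the
    kernels all arrows act by zero.

    Every point M of the fibre degenerates to this locus. Split each space into
    the image of E, the radical and a remainder. As Q is acyclic, a height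
    function increases along all arrows of the repetition quiver (height_arrow);
    scale the radical and the remainder by opposite powers of t, governed by the
    height. The radical and its sum with the image of E are submodules, so that the
    blocks scaled by negative powers vanish. The other exponents are positive,
    except on the block from the image of E to itself, and the limit for t -> 0
    has the matrices E y M b E x (limit_in_closure, limit_split).

    For M = L the limit is isomorphic to the direct sum of the intermediate
    extension and S, as all arrows act by zero on a semisimple module over the
    mesh category, again by height (semisimple_arrow0, limit_iso). So the locus is
    the orbit of this direct sum, is closed and lies in the closure of the orbit
    of L. Conversely a closed orbit in that closure lies in the fibre, which is
    closed; it contains the limit of its points, hence is the locus. *)

(** * Dual pairs and idempotents *)

Section DualPairs.
Variable k : fieldType.

(** The determinant of the block matrix is that of T times that of the Schur
    complement s - v T^-1 u, a non zero scalar. *)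
Lemma schur_unitmx n (T : 'M[k]_n) (u : 'cV_n) (v : 'rV_n) (s : 'M_1) :
  T \in unitmx -> s != v *m invmx T *m u -> block_mx T u v s \in unitmx.
Proof.
move=> Tu sN.
have -> : block_mx T u v s =
    block_mx 1%:M 0 (v *m invmx T) 1%:M *m block_mx T u 0 (s - v *m invmx T *m u).
  by rewrite mulmx_block !mul1mx !mul0mx !addr0 mulmxKV // [_ + (s - _)]addrC subrK.
rewrite unitmx_mul !unitmxE det_lblock det_ublock !det1 mulr1 unitr1 unitrM -unitmxE Tu /=.
rewrite det_mx11 unitfE.
apply: contraNneq sN => s0; rewrite -subr_eq0; apply/eqP/matrixP => i j.
by rewrite !ord1 s0 mxE.
Qed.

Definition extend_last r (T : Type) (f : 'I_r -> T) (t : T) (l : 'I_(r + 1)) : T :=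
  if fintype.split l is inl l' then f l' else t.

Variables (n : nat) (I J : Type) (A : I -> 'rV[k]_n) (B : J -> 'cV[k]_n).

Definition rows_mx r (f : 'I_r -> I) : 'M_(r, n) := \matrix_(i, l) A (f i) 0 l.
Definition cols_mx r (g : 'I_r -> J) : 'M_(n, r) := \matrix_(l, j) B (g j) l 0.

Lemma rows_mx_extend r (f : 'I_r -> I) i :
  rows_mx (extend_last f i) = col_mx (rows_mx f) (A i).
Proof.
apply/matrixP => a b; rewrite !mxE /extend_last.
by case: fintype.split => c; rewrite ?mxE ?ord1.
Qed.

Lemma cols_mx_extend r (g : 'I_r -> J) j :
  cols_mx (extend_last g j) = row_mx (cols_mx g) (B j).
Proof.
apply/matrixP => a b; rewrite !mxE /extend_last.
by case: fintype.split => c; rewrite ?mxE ?ord1.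
Qed.

(** Families of r rows and r columns whose matrix of pairings is invertible, and
    which factor the whole pairing, so that r is its rank. *)
Record dual_pair := DualPair {
  dp_rank : nat;
  dp_row : 'I_dp_rank -> I;
  dp_col : 'I_dp_rank -> J;
  dp_unit : rows_mx dp_row *m cols_mx dp_col \in unitmx;
  dp_factor : forall i j, A i *m B j =
    A i *m cols_mx dp_col *m invmx (rows_mx dp_row *m cols_mx dp_col)
        *m rows_mx dp_row *m B j }.

Definition dual_size r :=
  exists fg : ('I_r -> I) * ('I_r -> J), rows_mx fg.1 *m cols_mx fg.2 \in unitmx.

Lemma dual_size_le r : dual_size r -> (r <= n)%N.
Proof.
case=> fg u; have := mxrankM_maxl (rows_mx fg.1) (cols_mx fg.2).
by rewrite mxrank_unit // => h; apply: leq_trans h (rank_leq_col _).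
Qed.

Lemma row_rows_mx r (f : 'I_r -> I) i : row i (rows_mx f) = A (f i).
Proof. by apply/rowP => l; rewrite !mxE. Qed.

Lemma col_cols_mx r (g : 'I_r -> J) j : col j (cols_mx g) = B (g j).
Proof. by apply/colP => l; rewrite !mxE. Qed.

(** Take r maximal such that the matrix of pairings is invertible. If some row and
    column violated the factorization, adjoining them would give a larger matrix
    which is again invertible, its Schur complement being the defect. *)
Lemma dual_pair_exists : dual_pair.
Proof.
have ex : exists r, `[< dual_size r >].
  exists 0%N; apply/asboolP.
  (* the empty families *)
  by exists (fun i : 'I_0 => match notF (ltn_ord i) with end,
             fun i : 'I_0 => match notF (ltn_ord i) with end);
    rewrite unitmxE det_mx00 unitr1.
have le r : `[< dual_size r >] -> (r <= n)%N by move/asboolP; exact: dual_size_le.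
case: (ex_maxnP ex le) => r /asboolP/cid[[f g] /= u] max.
exists r f g => // i j; apply/eqP/negP => /negP NE.
suff : (r + 1 <= r)%N by rewrite addn1 ltnn.
apply: max; apply/asboolP.
exists (extend_last f i, extend_last g j) => /=.
rewrite rows_mx_extend cols_mx_extend mul_col_row.
by apply: schur_unitmx => //; move: NE; rewrite !mulmxA.
Qed.

End DualPairs.
Arguments dp_row {k n I J A B} d.
Arguments dp_col {k n I J A B} d.
Arguments dp_factor {k n I J A B} d.

Lemma mulmx_row_col (k : fieldType) m n p (A : 'M[k]_(m, n)) (B : 'M_(n, p)) i j :
  (A *m B) i j = (row i A *m col j B) 0 0.
Proof. by rewrite !mxE; apply: eq_bigr => l _; rewrite !mxE. Qed.

Lemma eq_mulmx_row_col (k : fieldType) m n n' p (A : 'M[k]_(m, n)) (B : 'M_(n, p))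
    (A' : 'M_(m, n')) (B' : 'M_(n', p)) :
  (forall i j, row i A *m col j B = row i A' *m col j B') -> A *m B = A' *m B'.
Proof. by move=> AB; apply/matrixP => i j; rewrite [LHS]mulmx_row_col [RHS]mulmx_row_col AB. Qed.

Section Idempotents.
Variable k : fieldType.

(** A and B identify the images of the idempotents E and F. As the images have the
    same dimension, so have the kernels, and A extends to an automorphism which
    carries also the kernel of E to that of F. *)
Lemma equiv_idempotents n (E F A B : 'M[k]_n) :
  E *m A = A -> A *m F = A -> A *m B = E -> B *m A = F ->
  exists2 g, g \in unitmx & E *m g = A /\ g *m F = A.
Proof.
move=> EA AF AB BA.
have EE : E *m E = E by rewrite -{2}AB mulmxA EA.
have FF : F *m F = F by rewrite -{1}BA -mulmxA AF.
have rk : \rank (E *m A) = \rank E.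
  apply/eqP; rewrite eqn_leq mxrankM_maxl EA.
  by have := mxrankM_maxl A B; rewrite AB.
have [g gu] := complete_unitmx rk; rewrite EA => AE.
(* g extends A from the image of E; correct it to carry ker E into ker F *)
exists (A + (1%:M - E) *m g *m (1%:M - F)); last first.
  split; first by rewrite [LHS]mulmxDr EA !mulmxA [E *m (_ - _)]mulmxBr mulmx1 EE subrr !mul0mx addr0.
  by rewrite [LHS]mulmxDl AF -!mulmxA [(_ - _) *m F]mulmxBl mul1mx FF subrr !mulmx0 addr0.
rewrite -row_free_unit; apply: inj_row_free => m.
rewrite [LHS]mulmxDr => m0.
have mA : m *m A = 0.
  have := congr1 (mulmx^~ F) m0; rewrite [LHS]mulmxDl mul0mx -!mulmxA AF.
  by rewrite [(1%:M - F) *m F]mulmxBl mul1mx FF subrr !mulmx0 addr0.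
have mE : m *m E = 0 by rewrite -AB mulmxA mA mul0mx.
move: m0; rewrite mA add0r !mulmxA [m *m (_ - _)]mulmxBr mulmx1 mE subr0 mulmxBr mulmx1 => /eqP.
rewrite subr_eq0 => /eqP mg.
have : m *m g = m *m g *m B *m E *m g by rewrite -[X in _ = X]mulmxA -AE -mulmxA BA.
move=> /(congr1 (mulmx^~ (invmx g))); rewrite !mulmxK // => mm.
by rewrite mm -EE mulmxA -mm mE.
Qed.

End Idempotents.

(** * Zariski closed sets and limits of curves *)

Section ZariskiTopology.
Variables (k : fieldType) (Q : finquiver) (d : zvert (framed Q) -> nat).
Local Notation rep := (rep k d).

Lemma regular_fun_sum (I : Type) (r : seq I) (F : I -> rep -> k) :
  (forall i, regular_fun (F i)) -> regular_fun (fun M => \sum_(i <- r) F i M).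
Proof.
move=> rF; elim: r => [|i r IH].
  have -> : (fun M => \sum_(i <- [::]) F i M) = (fun _ : rep => 0).
    by apply/funext => M; rewrite big_nil.
  exact: regular_fun_const.
have -> : (fun M => \sum_(j <- i :: r) F j M) = (fun M => F i M + \sum_(j <- r) F j M).
  by apply/funext => M; rewrite big_cons.
exact: regular_fun_add.
Qed.

Definition regular_mx m n (F : rep -> 'M[k]_(m, n)) : Prop :=
  forall i j, regular_fun (fun M => F M i j).

Lemma regular_mx_const m n (A : 'M[k]_(m, n)) : regular_mx (fun _ => A).
Proof. by move=> i j; exact: regular_fun_const. Qed.

Lemma regular_mx_arrow x y (b : zarr x y) : regular_mx (fun M : rep => M x y b).
Proof. by move=> i j; exact: regular_fun_coord. Qed.

Lemma regular_mxM m n p (F : rep -> 'M[k]_(m, n)) (G : rep -> 'M[k]_(n, p)) :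
  regular_mx F -> regular_mx G -> regular_mx (fun M => F M *m G M).
Proof.
move=> rF rG i j.
have -> : (fun M => (F M *m G M) i j) = (fun M => \sum_l F M i l * G M l j).
  by apply/funext => M; rewrite mxE.
by apply: regular_fun_sum => l; apply: regular_fun_mul.
Qed.

Lemma zariski_closed_forall (T : Type) (Z : T -> set rep) :
  (forall t, zariski_closed (Z t)) -> zariski_closed [set M | forall t, Z t M].
Proof.
move=> cZ; exists [set f | regular_fun f /\ exists t, Z t `<=` [set M | f M = 0]].
  by move=> f [].
apply/seteqP; split=> M /=.
  by move=> ZM f [_ [t]]; apply.
move=> MI t; have [I rI ZI] := cZ t; rewrite ZI => f If; apply: MI.
by split; [exact: rI | exists t => N; rewrite ZI; apply].
Qed.

Lemma zariski_closedI (Y Z : set rep) :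
  zariski_closed Y -> zariski_closed Z -> zariski_closed [set M | Y M /\ Z M].
Proof.
move=> cY cZ; pose W (b : bool) := if b then Y else Z.
have -> : [set M | Y M /\ Z M] = [set M | forall b, W b M].
  apply/seteqP; split=> M /=; first by case=> ? ? [].
  by move=> WM; split; [exact: (WM true) | exact: (WM false)].
by apply: zariski_closed_forall => -[].
Qed.

Lemma zariski_closed_eqmx m n (F G : rep -> 'M[k]_(m, n)) :
  regular_mx F -> regular_mx G -> zariski_closed [set M | F M = G M].
Proof.
move=> rF rG; exists [set f | exists i j, f = fun M => F M i j + -1 * G M i j].
  move=> _ [i [j ->]]; apply: regular_fun_add => //.
  by apply: regular_fun_mul => //; exact: regular_fun_const.
apply/seteqP; split=> M /=.
  by move=> FG _ [i [j ->]]; rewrite FG mulN1r subrr.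
move=> FG; apply/matrixP => i j; apply/eqP; rewrite -subr_eq0 -mulN1r.
by apply/eqP; apply: (FG (fun M => F M i j + -1 * G M i j)); exists i, j.
Qed.

Lemma zariski_closure_sub (Y Z : set rep) :
  zariski_closed Z -> Y `<=` Z -> zariski_closure Y `<=` Z.
Proof. by move=> cZ YZ M; apply; split. Qed.

(** Characteristic zero serves only to supply infinitely many non zero scalars, the
    positive integers. *)
Lemma poly_cofinite0 (p : {poly k}) : [pchar k] =i pred0 ->
  (forall t, t != 0 -> p.[t] = 0) -> p.[0] = 0.
Proof.
move=> /pcharf0P k0 p0; have [-> | pN0] := eqVneq p 0; first by rewrite horner0.
pose s : seq k := [seq n.+1%:R | n <- iota 0 (size p)].
have us : uniq s.
  rewrite map_inj_uniq ?iota_uniq // => a b.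
  wlog: a b / (a <= b)%N => [hw|ab /eqP].
    by case/orP: (leq_total a b) => [/hw//|/hw h /esym/h].
  rewrite eq_sym -subr_eq0 -natrB ?ltnS // k0 subn_eq0 ltnS => ba.
  by apply/eqP; rewrite eqn_leq ab.
have rs : all (root p) s.
  by apply/allP => _ /mapP[n _ ->]; apply/rootP/p0; rewrite k0.
by have := max_poly_roots pN0 rs us; rewrite size_map size_iota ltnn.
Qed.

(** A regular function vanishing at the values c t for t <> 0 is along c a
    polynomial in t with infinitely many zeros. *)
Lemma curve_limit (Z : set rep) (c : k -> rep) : [pchar k] =i pred0 ->
  (forall x y (b : zarr x y) i j, exists p : {poly k}, forall t, c t x y b i j = p.[t]) ->
  (forall t, t != 0 -> Z (c t)) -> zariski_closure Z (c 0).
Proof.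
move=> k0 pc cZ _ [[I rI ->] ZI] f If.
have [p pE] : exists p : {poly k}, forall t, f (c t) = p.[t].
  elim: (rI _ If) => [a|x y b i j|f1 f2 _ [p pE] _ [q qE]|f1 f2 _ [p pE] _ [q qE]].
  - by exists a%:P => t; rewrite hornerC.
  - exact: pc.
  - by exists (p + q) => t; rewrite hornerD pE qE.
  - by exists (p * q) => t; rewrite hornerM pE qE.
rewrite pE; apply: poly_cofinite0 => // t tN0.
by rewrite -pE; apply: ZI If; exact: cZ.
Qed.

End ZariskiTopology.

(** * Base change and orbits *)

Section BaseChange.
Variables (k : fieldType) (Q : finquiver) (d : zvert (framed Q) -> nat).
Local Notation rep := (rep k d).
Local Notation zpath := (qpath (@zarr (framed Q))).

Lemma rep_eq (M N : rep) : (forall x y (b : zarr x y), M x y b = N x y b) -> M = N.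
Proof.
case: M N => [M Mr] [N Nr] /= MN.
have {}MN : M = N.
  apply: functional_extensionality_dep => x; apply: functional_extensionality_dep => y.
  by apply/funext => b; exact: MN.
by case: _ / MN in Nr *; congr Rep; exact: Prop_irrelevance.
Qed.

(** Paths act on row vectors from the right and contravariantly: the matrix of a
    path from x to y maps row vectors at y to row vectors at x. *)
Fixpoint path_mx (M : rep) x y (p : zpath x y) : 'M[k]_(d y, d x) :=
  match p with
  | Pnil _ => 1%:M
  | Pcons _ _ _ b p' => path_mx M p' *m M _ _ b
  end.

Lemma path_mx_cat M x y z (p : zpath x y) (q : zpath y z) :
  path_mx M (catp p q) = path_mx M q *m path_mx M p.
Proof. by elim: p q => [x'|x' y' z' b p IH] q /=; rewrite ?mulmx1 // IH mulmxA. Qed.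

Lemma path_mx1 M x y (b : zarr x y) : path_mx M (path1 b) = M x y b.
Proof. by rewrite /= mul1mx. Qed.

Lemma regular_path_mx x y (p : zpath x y) : regular_mx (fun M => path_mx M p).
Proof.
elim: p => [x'|x' y' z b p IH] /=; first exact: regular_mx_const.
by apply: regular_mxM IH _; exact: regular_mx_arrow.
Qed.

Definition base_change (G : forall x, 'M[k]_(d x)) (M N : rep) : Prop :=
  forall x y (b : zarr x y), N x y b *m G x = G y *m M x y b.

Lemma base_change_path G M N : base_change G M N ->
  forall x y (p : zpath x y), path_mx N p *m G x = G y *m path_mx M p.
Proof.
move=> MN x y; elim=> [x'|x' y' z b p IH] /=; first by rewrite mulmx1 mul1mx.
by rewrite -mulmxA MN !mulmxA IH.
Qed.

Lemma base_change_rel (G : forall x, 'M[k]_(d x)) (M : rep) :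
  (forall x, G x \in unitmx) ->
  forall x y (f : {malg k[zpath x y]}), mesh_rel (@nonfrozen Q) f ->
  forall m, lpath_act (matrix_act (fun x y b => G y *m M x y b *m invmx (G x))) f m = 0.
Proof.
move=> Gu x y f rf m.
have := @rmat_rel _ _ _ M _ _ _ rf (m *m G y); case: rf m => z _ m.
rewrite !lpath_act_mesh /matrix_act => /(congr1 (mulmx^~ (invmx (G (tau z))))).
rewrite mul0mx mulmxDl !mulmx_suml; apply: etrans.
congr (_ + _); apply: eq_bigr => j _; rewrite mulmx_suml; apply: eq_bigr => a _;
  by rewrite !mulmxA mulmxKV.
Qed.

Definition conj_rep (G : forall x, 'M[k]_(d x)) (Gu : forall x, G x \in unitmx) (M : rep) : rep :=
  Rep (base_change_rel M Gu).

Lemma base_change_conj G Gu M : base_change G M (@conj_rep G Gu M).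
Proof. by move=> x y b /=; rewrite mulmxKV. Qed.

Lemma regular_conj_rep G Gu f : regular_fun f -> regular_fun (fun M => f (@conj_rep G Gu M)).
Proof.
elim=> [c|x y b i j|f1 f2 _ r1 _ r2|f1 f2 _ r1 _ r2] /=.
- exact: regular_fun_const.
- have : regular_mx (fun M : rep => G y *m M x y b *m invmx (G x)); last exact.
  apply: regular_mxM (regular_mx_const _ _); apply: regular_mxM (regular_mx_const _ _) _.
  exact: regular_mx_arrow.
- exact: regular_fun_add.
- exact: regular_fun_mul.
Qed.

Lemma zariski_closed_conj_rep G Gu (Z : set rep) :
  zariski_closed Z -> zariski_closed [set M | Z (@conj_rep G Gu M)].
Proof.
case=> I rI ->; exists [set g | exists2 f, I f & g = fun M => f (@conj_rep G Gu M)].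
  by move=> _ [f If ->]; apply: regular_conj_rep; exact: rI.
apply/seteqP; split=> M /= MI; first by move=> _ [f If ->]; exact: MI.
by move=> f If; apply: (MI (fun M => f (@conj_rep G Gu M))); exists f.
Qed.

End BaseChange.

Section Orbits.
Variables (k : fieldType) (Q : finquiver) (v w : {fsfun zvert Q -> nat with 0%N}).
Local Notation d := (dimvec v w).
Local Notation rep := (rep k d).

(** It is convenient to let the base change be given at all vertices, and be the
    identity at the frozen ones. *)
Lemma gorbitP (M N : rep) :
  gorbit M N <-> exists2 G : forall x, 'M[k]_(d x),
    (forall x, G x \in unitmx) /\ (forall u, G (fz u) = 1%:M) & base_change G M N.
Proof.
split=> [[g gu gN]|[G [Gu G1] GN]].
  have Gu x : gl_ext w g x \in unitmx by case: x => -[i|i] p /=; rewrite ?unitmx1.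
  exists (gl_ext w g); first by split=> // -[].
  by move=> x y b; rewrite gN mulmxKV.
exists (fun x => match x return 'M_(v x) with (i, p) => G (inl i, p) end).
  by case=> i p; exact: (Gu (inl i, p)).
have GE x : gl_ext w (fun x => match x return 'M_(v x) with (i, p) => G (inl i, p) end) x = G x.
  by case: x => -[i|i] p //=; rewrite -(G1 (i, p)).
by move=> x y b; rewrite !GE -GN mulmxK.
Qed.

Lemma gorbit_refl (M : rep) : gorbit M M.
Proof.
apply/gorbitP; exists (fun x => 1%:M); first by split=> // x; exact: unitmx1.
by move=> x y b; rewrite mulmx1 mul1mx.
Qed.

Lemma gorbit_sym (M N : rep) : gorbit M N -> gorbit N M.
Proof.
move/gorbitP => [G [Gu G1] GN]; apply/gorbitP; exists (fun x => invmx (G x)).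
  by split=> [x|u]; rewrite ?unitmx_inv // G1 invmx1.
move=> x y b; apply: (can_inj (mulmxK (Gu x))).
by rewrite mulmxKV // -mulmxA GN mulmxA mulVmx // mul1mx.
Qed.

Lemma gorbit_trans (M N P : rep) : gorbit M N -> gorbit N P -> gorbit M P.
Proof.
move/gorbitP => [G [Gu G1] GN] /gorbitP[H [Hu H1] HP]; apply/gorbitP.
exists (fun x => H x *m G x).
  by split=> [x|u]; rewrite ?unitmx_mul ?Gu ?Hu // G1 H1 mulmx1.
by move=> x y b; rewrite mulmxA HP -mulmxA GN mulmxA.
Qed.

Lemma gorbit_eq (M N : rep) : gorbit M N -> gorbit M = gorbit N.
Proof.
move=> MN; apply/seteqP; split=> P; apply: gorbit_trans => //; exact: gorbit_sym.
Qed.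

Lemma gorbit_conj_rep G (Gu : forall x, G x \in unitmx) (M : rep) :
  (forall u, G (fz u) = 1%:M) -> gorbit M (conj_rep Gu M).
Proof. by move=> G1; apply/gorbitP; exists G => //; exact: base_change_conj. Qed.

(** The group acts by homeomorphisms, so that the closure of an orbit is stable. *)
Lemma gorbit_closure (L M N : rep) :
  zariski_closure (gorbit L) M -> gorbit M N -> zariski_closure (gorbit L) N.
Proof.
move=> LM /gorbitP[G [Gu G1] GN] Z [Zcl LZ].
have -> : N = conj_rep Gu M.
  by apply: rep_eq => x y b /=; rewrite -GN mulmxK.
apply: (LM [set M | Z (conj_rep Gu M)]); split; first exact: zariski_closed_conj_rep.
by move=> P LP; apply: LZ; apply: gorbit_trans LP (gorbit_conj_rep Gu _ G1).
Qed.

End Orbits.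

(** * The projectors defined by the frozen part *)

Section PairingIdempotents.
Variables (k : fieldType) (Q : finquiver) (d : zvert (framed Q) -> nat).
Local Notation rep := (rep k d).
Local Notation zpath := (qpath (@zarr (framed Q))).

Definition out_index x : Type := {u : zvert Q & (zpath x (fz u) * 'I_(d (fz u)))%type}.
Definition in_index x : Type := {u : zvert Q & (zpath (fz u) x * 'I_(d (fz u)))%type}.

Definition out_row (M : rep) x (a : out_index x) : 'rV[k]_(d x) :=
  row (projT2 a).2 (path_mx M (projT2 a).1).
Definition in_col (M : rep) x (c : in_index x) : 'cV[k]_(d x) :=
  col (projT2 c).2 (path_mx M (projT2 c).1).

Variable L : rep.

(** At each vertex x, a path from x to a frozen vertex and a path from a frozen
    vertex to x compose to a path between frozen vertices. The pairing given by
    these composites depends only on the restriction of L to the frozen vertices;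
    its rank is the dimension at x of the intermediate Kan extension. *)
Definition pairing_basis x := dual_pair_exists (@out_row L x) (@in_col L x).

Definition out_mx M x := rows_mx (@out_row M x) (dp_row (pairing_basis x)).
Definition in_mx M x := cols_mx (@in_col M x) (dp_col (pairing_basis x)).
Definition gram x := out_mx L x *m in_mx L x.

(** With Q the chosen rows, P the chosen columns and T = Q P, the matrix P T^-1 Q is
    polynomial in the entries of M and is, on the fibre, a projector onto the span
    of Q along the annihilator of P. It is locked, since matching modulo
    associativity would otherwise unfold it. *)
Definition proj_mx M x : 'M[k]_(d x) :=
  locked (in_mx M x *m invmx (gram x) *m out_mx M x).

Lemma proj_mxE M x : proj_mx M x = in_mx M x *m invmx (gram x) *m out_mx M x.
Proof. by rewrite /proj_mx -lock. Qed.

(** The points with the same restriction to the frozen vertices as L *)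
Definition fibre : set rep :=
  [set M | forall u u' (p : zpath (fz u) (fz u')), path_mx M p = path_mx L p].

Lemma gram_unit x : gram x \in unitmx. Proof. exact: dp_unit. Qed.

Lemma mul_out_in M x (a : out_index x) (c : in_index x) :
  out_row M a *m in_col M c =
  col (projT2 c).2 (row (projT2 a).2 (path_mx M (catp (projT2 c).1 (projT2 a).1))).
Proof. by rewrite path_mx_cat row_mul colE -mulmxA -colE. Qed.

Section Fibre.
Variables (M : rep) (MF : fibre M).

Lemma fibre_pairing x (a : out_index x) (c : in_index x) :
  out_row M a *m in_col M c = out_row L a *m in_col L c.
Proof. by rewrite !mul_out_in MF. Qed.

Lemma fibre_gram x : out_mx M x *m in_mx M x = gram x.
Proof.
by apply: eq_mulmx_row_col => i j; rewrite !row_rows_mx !col_cols_mx fibre_pairing.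
Qed.

Lemma fibre_row_in x (a : out_index x) : out_row M a *m in_mx M x = out_row L a *m in_mx L x.
Proof.
apply: eq_mulmx_row_col => i j; rewrite ![row i _]row_id !col_cols_mx.
exact: fibre_pairing.
Qed.

Lemma fibre_out_col x (c : in_index x) : out_mx M x *m in_col M c = out_mx L x *m in_col L c.
Proof.
apply: eq_mulmx_row_col => i j; rewrite !row_rows_mx ![col j _]col_id.
exact: fibre_pairing.
Qed.

(** The factorization of the pairing of L by the chosen rows and columns holds at
    every point of the fibre, because it involves only pairings. *)
Lemma path_proj_path x u u' (q : zpath x (fz u)) (p : zpath (fz u') x) :
  path_mx M q *m proj_mx M x *m path_mx M p = path_mx M q *m path_mx M p.
Proof.
apply: eq_mulmx_row_col => i j.
pose a : out_index x := existT _ u (q, i); pose c : in_index x := existT _ u' (p, j).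
rewrite row_mul -/(out_row M a) -/(in_col M c) fibre_pairing.
rewrite (dp_factor (pairing_basis x) a c) proj_mxE.
rewrite -[LHS]mulmxA -[in LHS]mulmxA fibre_out_col !mulmxA fibre_row_in.
by [].
Qed.

Lemma fibre_out_arrow_in x y (b : zarr x y) :
  out_mx M y *m M x y b *m in_mx M x = out_mx L y *m L x y b *m in_mx L x.
Proof.
apply: eq_mulmx_row_col => i j; rewrite !row_mul !row_rows_mx !col_cols_mx.
pose a : out_index x := let: existT u (q, l) := dp_row (pairing_basis y) i in
  existT _ u (Pcons b q, l).
have aE N : out_row N (dp_row (pairing_basis y) i) *m N x y b = out_row N a.
  by rewrite /a /out_row; case: (dp_row _ i) => u [q l] /=; rewrite row_mul.
by rewrite !aE fibre_pairing.
Qed.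

Lemma fibre_in_mx_frozen u : in_mx M (fz u) = in_mx L (fz u).
Proof.
apply/matrixP => i j; rewrite !mxE; rewrite /in_col; case: (dp_col _ j) => u' [p l] /=.
by rewrite MF.
Qed.

(** At a frozen vertex the trivial path is both incoming and outgoing. *)
Lemma proj_frozen u : proj_mx M (fz u) = 1%:M.
Proof. by have := path_proj_path (Pnil _ (fz u)) (Pnil _ (fz u)); rewrite /= !mulmx1 mul1mx. Qed.

Lemma out_proj x : out_mx M x *m proj_mx M x = out_mx M x.
Proof. by rewrite proj_mxE !mulmxA fibre_gram mulmxV ?gram_unit // mul1mx. Qed.

Lemma proj_in x : proj_mx M x *m in_mx M x = in_mx M x.
Proof. by rewrite proj_mxE -mulmxA fibre_gram mulmxKV ?gram_unit. Qed.

Lemma proj_idem x : proj_mx M x *m proj_mx M x = proj_mx M x.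
Proof. by rewrite [X in _ *m X = _]proj_mxE !mulmxA proj_in -proj_mxE. Qed.

End Fibre.

(** The rows of X lie in the largest submodule of M which vanishes at the frozen
    vertices. *)
Definition in_radical M n x (X : 'M[k]_(n, d x)) :=
  forall u (p : zpath (fz u) x), X *m path_mx M p = 0.

Lemma radical_in_mx M n x (X : 'M[k]_(n, d x)) : in_radical M X -> X *m in_mx M x = 0.
Proof.
move=> X0; apply/matrixP => i j; rewrite mulmx_row_col col_cols_mx.
by rewrite -mulmx_row_col X0 !mxE.
Qed.

Lemma radical_proj M n x (X : 'M[k]_(n, d x)) : in_radical M X -> X *m proj_mx M x = 0.
Proof. by move=> X0; rewrite proj_mxE !mulmxA radical_in_mx // !mul0mx. Qed.

Lemma radical_mull M m n x (Y : 'M_(m, n)) (X : 'M[k]_(n, d x)) :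
  in_radical M X -> in_radical M (Y *m X).
Proof. by move=> X0 u p; rewrite -mulmxA X0 mulmx0. Qed.

Lemma radical_path M n x y (p : zpath x y) (X : 'M[k]_(n, d y)) :
  in_radical M X -> in_radical M (X *m path_mx M p).
Proof. by move=> X0 u q; rewrite -mulmxA -path_mx_cat X0. Qed.

Lemma radical_arrow M n x y (b : zarr x y) (X : 'M[k]_(n, d y)) :
  in_radical M X -> in_radical M (X *m M x y b).
Proof. by rewrite -(path_mx1 M b); exact: radical_path. Qed.

(** The image of proj_mx lies in the submodule generated by the frozen vertices, and
    on that submodule proj_mx is the identity modulo the radical. *)
Lemma proj_path_radical M x y (p : zpath x y) : fibre M ->
  in_radical M (proj_mx M y *m path_mx M p *m (1%:M - proj_mx M x)).
Proof.
move=> MF u r; rewrite [proj_mx M y]proj_mxE -!mulmxA.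
suff -> : out_mx M y *m (path_mx M p *m ((1%:M - proj_mx M x) *m path_mx M r)) = 0.
  by rewrite !mulmx0.
apply/row_matrixP => i; rewrite row_mul row_rows_mx row0 /out_row -row_mul.
case: (dp_row _ _) => u' [q j] /=.
have := path_proj_path MF (catp p q) r; rewrite path_mx_cat -!mulmxA => e.
by rewrite mulmxBl mul1mx !mulmxBr e subrr row0.
Qed.

(** A dual pair for the pairing of the vectors of the radical with all columns gives
    a projector onto the radical. *)
Definition radical_basis M x :=
  dual_pair_exists (fun m : {m : 'rV[k]_(d x) | in_radical M m} => sval m) (@id 'cV_(d x)).

Definition radical_proj0 M x : 'M[k]_(d x) :=
  let P := cols_mx id (dp_col (radical_basis M x)) in
  let Q := rows_mx (fun m => sval m) (dp_row (radical_basis M x)) in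
  P *m invmx (Q *m P) *m Q.

Lemma radical_proj0_in M x : in_radical M (radical_proj0 M x).
Proof.
apply: radical_mull => u p; apply/row_matrixP => i.
by rewrite row_mul row_rows_mx (svalP (dp_row _ i)) row0.
Qed.

Lemma radical_proj0_id M n x (X : 'M_(n, d x)) : in_radical M X -> X *m radical_proj0 M x = X.
Proof.
move=> X0; apply/row_matrixP => i; rewrite row_mul; apply/matrixP => a j.
have ri : in_radical M (row i X) by move=> u p; rewrite -row_mul X0 row0.
have := dp_factor (radical_basis M x) (exist _ (row i X) ri) (col j 1%:M).
rewrite /= !colE !mul1mx -!colE => /matrixP/(_ a 0).
by rewrite ![col j _ _ _]mxE ord1 /radical_proj0 !mulmxA => ->.
Qed.

(** The correction by 1 - E makes the projector onto the radical orthogonal to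
    E = proj_mx; with rest_mx the identity splits into three orthogonal
    idempotents. *)
Definition rad_mx M x : 'M[k]_(d x) :=
  locked ((1%:M - proj_mx M x) *m radical_proj0 M x).
Definition rest_mx M x : 'M[k]_(d x) := locked (1%:M - proj_mx M x - rad_mx M x).

Lemma rad_mxE M x : rad_mx M x = (1%:M - proj_mx M x) *m radical_proj0 M x.
Proof. by rewrite /rad_mx -lock. Qed.

Lemma rest_mxE M x : rest_mx M x = 1%:M - proj_mx M x - rad_mx M x.
Proof. by rewrite /rest_mx -lock. Qed.

Lemma rad_mx_in M x : in_radical M (rad_mx M x).
Proof. rewrite rad_mxE; exact: radical_mull (@radical_proj0_in M x). Qed.

Lemma rad_mx_id M n x (X : 'M_(n, d x)) : in_radical M X -> X *m rad_mx M x = X.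
Proof.
move=> X0; rewrite rad_mxE mulmxA mulmxBr mulmx1 radical_proj // subr0.
exact: radical_proj0_id.
Qed.

Lemma rest_mx_id M n x (X : 'M_(n, d x)) : in_radical M X -> X *m rest_mx M x = 0.
Proof.
by move=> X0; rewrite rest_mxE !mulmxBr mulmx1 radical_proj // rad_mx_id // subr0 subrr.
Qed.

Lemma decomp_mx M x : proj_mx M x + rad_mx M x + rest_mx M x = 1%:M.
Proof. by rewrite rest_mxE -addrA [rad_mx _ _ + _]addrC subrK addrC subrK. Qed.

Lemma rad_mx_frozen M u : fibre M -> rad_mx M (fz u) = 0.
Proof. by move=> MF; rewrite rad_mxE proj_frozen // subrr mul0mx. Qed.

Lemma rest_mx_frozen M u : fibre M -> rest_mx M (fz u) = 0.
Proof. by move=> MF; rewrite rest_mxE rad_mx_frozen // proj_frozen // subrr subr0. Qed.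

(** These are the points of the fibre which are the direct sum of the image of
    proj_mx, on which they are determined by the pairings, and of a module on which
    all arrows act by zero. The conditions are polynomial equations. *)
Definition split_locus : set rep :=
  [set M | fibre M /\ forall x y (b : zarr x y),
     proj_mx M y *m M x y b = M x y b /\ M x y b *m proj_mx M x = M x y b].

Lemma regular_out_mx x : regular_mx (fun M => out_mx M x).
Proof.
move=> i j; set a := dp_row (pairing_basis x) i.
have -> : (fun M => out_mx M x i j) = fun M => path_mx M (projT2 a).1 (projT2 a).2 j.
  by apply/funext => M; rewrite !mxE.
exact: regular_path_mx.
Qed.

Lemma regular_in_mx x : regular_mx (fun M => in_mx M x).
Proof.
move=> i j; set a := dp_col (pairing_basis x) j.
have -> : (fun M => in_mx M x i j) = fun M => path_mx M (projT2 a).1 i (projT2 a).2.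
  by apply/funext => M; rewrite !mxE.
exact: regular_path_mx.
Qed.

Lemma regular_proj_mx x : regular_mx (fun M => proj_mx M x).
Proof.
have -> : (fun M => proj_mx M x) = fun M => in_mx M x *m invmx (gram x) *m out_mx M x.
  by apply/funext => M; rewrite proj_mxE.
apply: regular_mxM; last exact: regular_out_mx.
by apply: regular_mxM; [exact: regular_in_mx | exact: regular_mx_const].
Qed.

Lemma fibre_closed : zariski_closed fibre.
Proof.
do 3!apply: zariski_closed_forall => ?; apply: zariski_closed_eqmx.
  exact: regular_path_mx.
exact: regular_mx_const.
Qed.

Lemma split_locus_closed : zariski_closed split_locus.
Proof.
apply: zariski_closedI; first exact: fibre_closed.
do 3!apply: zariski_closed_forall => ?.
by apply: zariski_closedI; apply: zariski_closed_eqmx; try apply: regular_mxM;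
  solve [exact: regular_mx_arrow | exact: regular_proj_mx].
Qed.

Lemma base_change_fibre (G : forall x, 'M[k]_(d x)) M N :
  (forall u, G (fz u) = 1%:M) -> base_change G M N -> fibre M -> fibre N.
Proof.
move=> G1 MN MF u u' p; rewrite -MF.
by have := base_change_path MN p; rewrite !G1 mulmx1 mul1mx.
Qed.

Lemma base_change_proj (G : forall x, 'M[k]_(d x)) M N :
  (forall x, G x \in unitmx) -> (forall u, G (fz u) = 1%:M) -> base_change G M N ->
  forall x, proj_mx N x *m G x = G x *m proj_mx M x.
Proof.
move=> Gu G1 MN x.
have Qc : out_mx N x *m G x = out_mx M x.
  apply/row_matrixP => i; rewrite row_mul !row_rows_mx /out_row -row_mul.
  by rewrite (base_change_path MN) G1 mul1mx.
have Pc : in_mx N x = G x *m in_mx M x.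
  apply/matrixP => i j; rewrite mulmx_row_col [LHS]mxE col_cols_mx -mulmx_row_col.
  rewrite -(base_change_path MN) G1 mulmx1.
  by rewrite mxE.
by rewrite !proj_mxE -mulmxA Qc Pc !mulmxA.
Qed.

Lemma base_change_split (G : forall x, 'M[k]_(d x)) M N :
  (forall x, G x \in unitmx) -> (forall u, G (fz u) = 1%:M) -> base_change G M N ->
  split_locus M -> split_locus N.
Proof.
move=> Gu G1 MN [MF MS]; split; first exact: base_change_fibre MF.
move=> x y b; have [M1 M2] := MS x y b.
have pE := base_change_proj Gu G1 MN.
split; apply: (can_inj (mulmxK (Gu x))).
  by rewrite -mulmxA MN mulmxA pE -mulmxA M1.
by rewrite -mulmxA pE mulmxA MN -mulmxA M2.
Qed.

(** At two points of the locus the rows Q chosen from paths span the images of the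
    projectors and have the same pairings, so that matching them gives an
    isomorphism between these images. Between the kernels, where all arrows act by
    zero, any linear isomorphism will do. *)
Lemma split_locus_base_change M N : split_locus M -> split_locus N ->
  exists2 G : forall x, 'M[k]_(d x),
    (forall x, G x \in unitmx) /\ (forall u, G (fz u) = 1%:M) & base_change G M N.
Proof.
move=> [MF MS] [NF NS].
pose A x : 'M[k]_(d x) := in_mx N x *m invmx (gram x) *m out_mx M x.
pose B x : 'M[k]_(d x) := in_mx M x *m invmx (gram x) *m out_mx N x.
have ex x : {G : 'M[k]_(d x) | G \in unitmx & proj_mx N x *m G = A x /\ G *m proj_mx M x = A x}.
  apply/cid2/(@equiv_idempotents _ _ _ _ _ (B x)).
  - by rewrite /A !mulmxA proj_in.
  - by rewrite /A -[LHS]mulmxA out_proj.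
  - by rewrite /A /B -!mulmxA (mulmxA (out_mx M x)) fibre_gram // mulKVmx ?gram_unit // mulmxA -proj_mxE.
  - by rewrite /A /B -!mulmxA (mulmxA (out_mx N x)) fibre_gram // mulKVmx ?gram_unit // mulmxA -proj_mxE.
exists (fun x => s2val (ex x)).
  split=> [x|u]; first exact: (s2valP (ex x)).
  case: (ex (fz u)) => G _ [+ _] /=; rewrite proj_frozen // mul1mx => ->.
  by rewrite /A (fibre_in_mx_frozen NF) -(fibre_in_mx_frozen MF) -proj_mxE proj_frozen.
move=> x y b; case: (ex x) (ex y) => [Gx _ [Ax _]] [Gy _ [_ Ay]] /=.
have [M1 M2] := MS x y b; have [N1 N2] := NS x y b.
rewrite -M1 -N2 -mulmxA Ax mulmxA Ay -N1 -M2.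
have /esym := fibre_out_arrow_in NF b; rewrite -(fibre_out_arrow_in MF) => MNb.
rewrite /A !proj_mxE -!mulmxA; congr (_ *m (_ *m _)).
by rewrite !mulmxA MNb.
Qed.

End PairingIdempotents.

(** * Degeneration by a one-parameter subgroup *)

Section Degeneration.
Variables (k : fieldType) (Q : finquiver) (d : zvert (framed Q) -> nat).
Local Notation rep := (rep k d).
Local Notation zpath := (qpath (@zarr (framed Q))).
Variables (L M : rep).
Hypothesis MF : fibre L M.
Local Notation E := (proj_mx L M).
Local Notation P := (rad_mx L M).
Local Notation H := (rest_mx L M).

Lemma proj_proj_mx x : E x *m E x = E x. Proof. exact: proj_idem. Qed.
Lemma proj_rad_mx x : E x *m P x = 0.
Proof. by rewrite rad_mxE mulmxA mulmxBr mulmx1 proj_idem // subrr mul0mx. Qed.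
Lemma rad_proj_mx x : P x *m E x = 0.
Proof. exact: radical_proj (@rad_mx_in _ _ _ _ _ _). Qed.
Lemma rad_rad_mx x : P x *m P x = P x.
Proof. exact: rad_mx_id (@rad_mx_in _ _ _ _ _ _). Qed.
Lemma rad_rest_mx x : P x *m H x = 0.
Proof. exact: rest_mx_id (@rad_mx_in _ _ _ _ _ _). Qed.
Lemma proj_rest_mx x : E x *m H x = 0.
Proof. by rewrite rest_mxE !mulmxBr mulmx1 proj_proj_mx proj_rad_mx subrr subr0. Qed.
Lemma rest_proj_mx x : H x *m E x = 0.
Proof. by rewrite rest_mxE !mulmxBl mul1mx proj_proj_mx rad_proj_mx subrr subr0. Qed.
Lemma rest_rad_mx x : H x *m P x = 0.
Proof. by rewrite rest_mxE !mulmxBl mul1mx proj_rad_mx rad_rad_mx subr0 subrr. Qed.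
Lemma rest_rest_mx x : H x *m H x = H x.
Proof. by rewrite {2}rest_mxE !mulmxBr mulmx1 rest_proj_mx rest_rad_mx !subr0. Qed.

Lemma proj_arrow_rest x y (b : zarr x y) : E y *m M x y b *m H x = 0.
Proof.
have := rest_mx_id L (proj_path_radical (path1 b) MF).
by rewrite path_mx1 -mulmxA mulmxBl mul1mx proj_rest_mx subr0.
Qed.

Lemma rad_arrow_proj x y (b : zarr x y) : P y *m M x y b *m E x = 0.
Proof. by apply: radical_proj; apply: radical_arrow; exact: rad_mx_in. Qed.

Lemma rad_arrow_rest x y (b : zarr x y) : P y *m M x y b *m H x = 0.
Proof. by apply: rest_mx_id; apply: radical_arrow; exact: rad_mx_in. Qed.

(** An intermediate E y may be inserted: it changes the vector by an element of the
    radical, which the final E kills. *)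
Lemma proj_path_arrow x y z (b : zarr x y) (p : zpath y z) :
  E z *m path_mx M p *m E y *m M x y b *m E x = E z *m path_mx M p *m M x y b *m E x.
Proof.
apply/esym/eqP; rewrite -subr_eq0 -!mulmxBl -{1}[_ *m path_mx M p]mulmx1 -mulmxBr.
by rewrite radical_proj //; apply: radical_arrow; exact: proj_path_radical.
Qed.

(** Applied to a vector in the image of E, a mesh relation for M holds; inserting the
    intermediate projectors gives it for the matrices E y M E x. *)
Lemma limit_rel x y (f : {malg k[(zpath x y)]}) : mesh_rel (@nonfrozen Q) f ->
  forall m, lpath_act (matrix_act (fun x y b => E y *m M x y b *m E x)) f m = 0.
Proof.
move=> rf m.
have := @rmat_rel _ _ _ M _ _ _ rf (m *m E y); case: rf m => z _ m.
rewrite !lpath_act_mesh /matrix_act => /(congr1 (mulmx^~ (E (tau z)))).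
rewrite mul0mx mulmxDl !mulmx_suml; apply: etrans.
have e y' (c : zarr y' z) (b : zarr (tau z) y') :
    m *m (E z *m M _ _ c *m E y') *m (E y' *m M _ _ b *m E (tau z)) =
    m *m E z *m M _ _ c *m M _ _ b *m E (tau z).
  rewrite -!mulmxA; congr (m *m _); rewrite (mulmxA (E y') (E y')) proj_proj_mx !mulmxA.
  by have := proj_path_arrow b (path1 c); rewrite path_mx1.
by congr (_ + _); apply: eq_bigr => j _; rewrite mulmx_suml; apply: eq_bigr => a _.
Qed.

Definition limit_rep : rep := Rep limit_rel.

Lemma limit_path x y (p : zpath x y) :
  E y *m path_mx limit_rep p *m E x = E y *m path_mx M p *m E x.
Proof.
elim: p => [x'|x' y' z b p IH] /=; first by rewrite mulmx1.
rewrite !mulmxA IH -(mulmxA _ (E x') (E x')) proj_proj_mx.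
by rewrite proj_path_arrow.
Qed.

Lemma limit_path_l x y (p : zpath x y) :
  E y *m path_mx limit_rep p *m E x = path_mx limit_rep p *m E x.
Proof.
elim: p => [x'|x' y' z b p IH] /=; first by rewrite mulmx1 mul1mx proj_proj_mx.
by rewrite !mulmxA IH.
Qed.

Lemma limit_path_r x y (p : zpath x y) :
  E y *m path_mx limit_rep p *m E x = E y *m path_mx limit_rep p.
Proof.
case: p => [x'|x' y' z b p] /=; first by rewrite mulmx1 proj_proj_mx.
by rewrite -!mulmxA proj_proj_mx.
Qed.

Lemma limit_out_path x u (p : zpath x (fz u)) :
  path_mx limit_rep p = path_mx M p *m E x.
Proof.
by have := limit_path p; rewrite limit_path_r proj_frozen // !mul1mx.
Qed.

Lemma limit_in_path u x (p : zpath (fz u) x) :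
  path_mx limit_rep p = E x *m path_mx M p.
Proof.
by have := limit_path p; rewrite limit_path_l proj_frozen // !mulmx1.
Qed.

Lemma limit_fibre : fibre L limit_rep.
Proof. by move=> u u' p; rewrite limit_out_path proj_frozen // mulmx1 MF. Qed.

Lemma limit_proj x : proj_mx L limit_rep x = E x.
Proof.
have Qe : out_mx L limit_rep x = out_mx L M x.
  rewrite -(out_proj MF); apply/row_matrixP => i.
  by rewrite row_mul !row_rows_mx /out_row -row_mul limit_out_path.
have Pe : in_mx L limit_rep x = in_mx L M x.
  rewrite -(proj_in MF); apply/matrixP => i j.
  rewrite mulmx_row_col [LHS]mxE col_cols_mx -mulmx_row_col -limit_in_path.
  by rewrite mxE.
by rewrite [LHS]proj_mxE Qe Pe -proj_mxE.
Qed.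

Lemma limit_split : split_locus L limit_rep.
Proof.
split; first exact: limit_fibre.
move=> x y b; rewrite !limit_proj /=.
by rewrite !mulmxA proj_proj_mx -(mulmxA _ (E x) (E x)) proj_proj_mx.
Qed.

(** A weight function for the radical and one for the remaining summand, the first
    decreasing and the second increasing along the arrows. *)
Variables (a a' : zvert (framed Q) -> nat).
Hypothesis a_gt0 : forall x, (0 < a x)%N.
Hypothesis a'_gt0 : forall x, (0 < a' x)%N.
Hypothesis arrow_weight : forall x y (b : zarr x y), nonfrozen x -> nonfrozen y ->
  (0 < d x)%N -> (0 < d y)%N -> (a y < a x)%N /\ (a' x < a' y)%N.

Section Curve.
Variable t : k.

(** A one-parameter subgroup: the block of M b from the summand i at y to the summand
    j at x is multiplied by a power of t whose exponent is the difference of the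
    weights. The blocks for which it would not be positive vanish, except that from
    the image of proj_mx to itself, which is constant. *)
Definition scale_mx x : 'M[k]_(d x) := E x + t ^- a x *: P x + t ^+ a' x *: H x.
Definition scale_inv_mx x : 'M[k]_(d x) := E x + t ^+ a x *: P x + t ^- a' x *: H x.

Definition simp_mx := (proj_proj_mx, proj_rad_mx, proj_rest_mx, rad_proj_mx, rad_rad_mx,
  rad_rest_mx, rest_proj_mx, rest_rad_mx, rest_rest_mx).

Lemma scale_mx_unit x : t != 0 -> scale_mx x \in unitmx.
Proof.
move=> t0; suff /mulmx1_unit[]: scale_mx x *m scale_inv_mx x = 1%:M by [].
rewrite /scale_mx /scale_inv_mx !(mulmxDl, mulmxDr) -!(scalemxAl, scalemxAr) !simp_mx.
rewrite !scaler0 !(addr0, add0r) !scalerA mulVf ?mulfV ?expf_neq0 // !scale1r.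
exact: decomp_mx.
Qed.

Lemma scale_mx_frozen u : scale_mx (fz u) = 1%:M.
Proof.
by rewrite /scale_mx proj_frozen // rad_mx_frozen // rest_mx_frozen // !scaler0 !addr0.
Qed.

Definition curve_mx x y (b : zarr x y) : 'M[k]_(d y, d x) :=
  E y *m M x y b *m E x + t ^+ a x *: (E y *m M x y b *m P x)
  + t ^+ (a x - a y) *: (P y *m M x y b *m P x)
  + t ^+ a' y *: (H y *m M x y b *m E x)
  + t ^+ (a' y + a x) *: (H y *m M x y b *m P x)
  + t ^+ (a' y - a' x) *: (H y *m M x y b *m H x).

End Curve.

(** The weight inequalities are known only at non zero spaces over non frozen
    vertices; elsewhere the blocks which they concern vanish. *)
Lemma weight_cases x y (b : zarr x y) :
  ((a y < a x)%N /\ (a' x < a' y)%N) \/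
  (P y *m M x y b *m P x = 0 /\ H y *m M x y b *m H x = 0).
Proof.
have [dx|dx] := posnP (d x).
  by right; split; apply/matrixP => i j; have := ltn_ord j; rewrite [X in (_ < X)%N]dx.
have [dy|dy] := posnP (d y).
  by right; split; apply/matrixP => i j; have := ltn_ord i; rewrite [X in (_ < X)%N]dy.
case: x b dx => -[i|i] p b dx; last first.
  by right; rewrite (rad_mx_frozen (i, p)) // (rest_mx_frozen (i, p)) // !mulmx0.
case: y b dy => -[j|j] q b dy; last first.
  by right; rewrite (rad_mx_frozen (j, q)) // (rest_mx_frozen (j, q)) // !mul0mx.
by left; apply: arrow_weight b _ _ dx dy.
Qed.

Lemma curve_scale t x y (b : zarr x y) : t != 0 ->
  curve_mx t b *m scale_mx t x = scale_mx t y *m M x y b.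
Proof.
move=> t0.
have dec : M x y b = M x y b *m E x + M x y b *m P x + M x y b *m H x.
  by rewrite -!mulmxDr decomp_mx mulmx1.
rewrite [in RHS]dec /scale_mx /curve_mx !(mulmxDl, mulmxDr) -!(scalemxAl, scalemxAr) -!mulmxA !simp_mx.
rewrite !mulmx0 !scaler0 !(addr0, add0r) !mulmxA.
rewrite rad_arrow_proj rad_arrow_rest proj_arrow_rest !scaler0 !(addr0, add0r).
have tn n : t ^+ n != 0 by rewrite expf_neq0.
rewrite !scalerA mulfV // scale1r exprD mulfK // !addrA [RHS](ACl (1*3*4*2*5*6)) /=.
congr (_ + _ + _ + _ + _ + _).
  have [[lt _]|[-> _]] := weight_cases b; last by rewrite !scaler0.
  by rewrite expfB // mulrAC mulfV // mul1r.
have [[_ lt]|[_ ->]] := weight_cases b; last by rewrite !scaler0.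
by rewrite expfB // mulfVK.
Qed.

Lemma curve_mx0 x y (b : zarr x y) : curve_mx 0 b = limit_rep x y b.
Proof.
rewrite /curve_mx !expr0n.
have n0 n : (0 < n)%N -> (n == 0%N) = false by case: n.
rewrite !(n0 _ (a_gt0 _)) !(n0 _ (a'_gt0 _)) (n0 (_ + _)%N) ?addn_gt0 ?a_gt0 ?orbT // !scale0r !addr0.
have [[lt lt']|[-> ->]] := weight_cases b; last by rewrite !scaler0 !addr0.
by rewrite !n0 ?subn_gt0 // !scale0r !addr0.
Qed.

Lemma curve_mx_poly x y (b : zarr x y) i j :
  exists p : {poly k}, forall t, curve_mx t b i j = p.[t].
Proof.
exists (((E y *m M x y b *m E x) i j)%:P + 'X^(a x) * ((E y *m M x y b *m P x) i j)%:P
  + 'X^(a x - a y) * ((P y *m M x y b *m P x) i j)%:P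
  + 'X^(a' y) * ((H y *m M x y b *m E x) i j)%:P
  + 'X^(a' y + a x) * ((H y *m M x y b *m P x) i j)%:P
  + 'X^(a' y - a' x) * ((H y *m M x y b *m H x) i j)%:P) => t.
have lE (A B : 'M[k]_(d y, d x)) c : (A + c *: B) i j = A i j + c * B i j by rewrite !mxE.
by rewrite /curve_mx !lE !hornerE.
Qed.

(** The curve t |-> curve_mx t runs in the orbit of M for t <> 0. *)
Lemma limit_in_closure (Z : set rep) : [pchar k] =i pred0 ->
  (forall (G : forall x, 'M[k]_(d x)) (N : rep), (forall x, G x \in unitmx) ->
     (forall u, G (fz u) = 1%:M) -> base_change G M N -> Z N) ->
  zariski_closure Z limit_rep.
Proof.
move=> k0 ZM.
pose c t : rep := if pselect (t != 0) is left t0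
  then conj_rep (fun x => scale_mx_unit x t0) M else limit_rep.
have cE t x y (b : zarr x y) : c t x y b = curve_mx t b.
  rewrite /c; case: pselect => [t0|/negP/negPn/eqP ->]; last by rewrite curve_mx0.
  by apply: (can_inj (mulmxK (scale_mx_unit x t0))); rewrite curve_scale //= mulmxKV ?scale_mx_unit.
have -> : limit_rep = c 0 by apply: rep_eq => x y b; rewrite cE curve_mx0.
apply: curve_limit => // [x y b i j|t t0].
  by have [p pE] := curve_mx_poly b i j; exists p => t; rewrite cE.
apply: (ZM (scale_mx t)) => [x|u|x y b]; first exact: scale_mx_unit.
  exact: scale_mx_frozen.
by rewrite cE curve_scale.
Qed.

End Degeneration.

(** * Heights on the repetition quiver *)

Section Height.
Variable Q : finquiver.
Hypothesis Qac : acyclic Q.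

(** Without cycles, the number of vertices with a path to i grows along arrows. *)
Definition level (i : Q) : nat := #|[pred j | `[< inhabited (qpath (@qarr Q) j i) >]]|.

Lemma level_arrow i j (a : qarr i j) : (level i < level j)%N.
Proof.
apply/proper_card/properP; split.
  apply/fintype.subsetP => l /asboolP[p]; apply/asboolP.
  by split; exact: catp p (path1 a).
exists j; first by apply/asboolP; split; exact: Pnil.
by apply/negP => /asboolP[p]; have := Qac (Pcons a p).
Qed.

(** A translation by tau outweighs any difference of levels, so that the height
    increases also along the arrows sigma(a, p). *)
Definition height (x : zvert Q) : int := (level x.1)%:Z + x.2 * (#|Q|.+1)%:Z.

Lemma height_arrow x y : zarr x y -> (height x < height y)%R.
Proof.
have le (i : Q) : (level i <= #|Q|)%N by exact: max_card.
rewrite /height => -[a ->|a ->]; have := level_arrow a; first lia.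
have := le x.1; have := le y.1; rewrite mulrBl; lia.
Qed.

Lemma height_path x y : qpath (@zarr Q) x y -> (height x <= height y)%R.
Proof. by elim=> [//|x' y' z b p]; have := height_arrow b; lia. Qed.

Definition nf_arrow i p j q (b : @zarr (framed Q) (inl i, p) (inl j, q)) :
    @zarr Q (i, p) (j, q) :=
  match b with
  | ZArr a e => @ZArr Q (i, p) (j, q) a e
  | ZSigma a e => @ZSigma Q (i, p) (j, q) a e
  end.

(** On the finite support of v the height is bounded by some c; take c - height and
    c + height, made positive everywhere. *)
Lemma arrow_weights (v w : {fsfun zvert Q -> nat with 0%N}) :
  exists a a' : zvert (framed Q) -> nat, [/\ forall x, (0 < a x)%N, forall x, (0 < a' x)%N &
    forall x y, zarr x y -> nonfrozen x -> nonfrozen y ->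
    (0 < dimvec v w x)%N -> (0 < dimvec v w y)%N -> (a y < a x)%N /\ (a' x < a' y)%N].
Proof.
pose c := \max_(x <- finsupp v) `|height x|%N.
have cP x : (0 < v x)%N -> (`|height x| <= c)%N.
  move=> vx; apply: (@leq_bigmax_seq _ _ xpredT (fun x => `|height x|%N)) => //.
  by rewrite mem_finsupp -lt0n.
pose h (x : zvert (framed Q)) : int := if x is (inl i, p) then height (i, p) else 0.
exists (fun x => `|c%:Z - h x|.+1), (fun x => `|c%:Z + h x|.+1); split=> // x y.
case: x y => -[i|//] p [[j|//] q] b _ _ /= /cP hx /cP hy.
by have := height_arrow (nf_arrow b); split; lia.
Qed.

End Height.

Section SemisimpleMesh.
Variables (k : fieldType) (Q : finquiver) (S : rmod (mesh_category k Q)).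
Hypothesis Qac : acyclic Q.

Section Truncation.
Variable n : int.

(** The part of S in heights at most n is a submodule, as morphisms go up and act
    contravariantly. *)
Lemma truncation_linear x (a : k) (m m' : S x) :
  (height x <= n)%R \/ m = 0 -> (height x <= n)%R \/ m' = 0 ->
  (height x <= n)%R \/ a *: m + m' = 0.
Proof.
case=> [|->]; first by left.
by case=> [|->]; [left | right; rewrite scaler0 addr0].
Qed.

Definition truncation_at (x : zvert Q) : subspace (S x) :=
  Subspace (or_intror erefl) (@truncation_linear x).

Lemma truncation_act x y (f : Defs.hom (x : mesh_category k Q) y) (m : S y) :
  truncation_at y m -> truncation_at x (mact f m).
Proof.
case=> [hy|->]; last by right; exact: mact0r.
have [[p]|np] := pselect (inhabited (qpath (@zarr Q) x y)).
  by left; have := height_path Qac p; lia.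
right; rewrite -[f]qreprK (mact_lpath (qrepr f)) /lpath_act /lin_ext.
by apply: big1 => p; case: np.
Qed.

Definition truncation : submod S := Submod truncation_act.

End Truncation.

(** Truncate at the height of x. The truncation is zero at y, so that m lies in a
    complement of it; but at x it is everything. Hence b maps m into the zero
    intersection of both. *)
Lemma semisimple_arrow0 x y (b : zarr x y) (m : S y) : semisimple S ->
  mact (pres_arrow (@mesh_rel k Q xpredT) b : Defs.hom (x : mesh_category k Q) y) m = 0.
Proof.
move=> /(_ (truncation (height x)))[P' [dec disj]].
have [p [p' [/= [hp|->] Pp' ->]]] := dec y m; first by have := height_arrow Qac b; lia.
rewrite add0r; apply: disj; last exact: submod_act.
by left; lia.
Qed.

End SemisimpleMesh.

(** * The intermediate Kan extension of a restriction *)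

Section KanImage.
Variables (k : fieldType) (A : lincat k) (O : Type) (iota : O -> A).
Variables (KL : left_adjoint iota) (KR : right_adjoint iota) (M : rmod A).
Local Notation resM := (restr iota M).

Definition idm_res : rmor resM resM := restr_mor iota (@RMor k A M M (fun x m => m)
  (fun x a m n => erefl) (fun x y f m => erefl)).

(** The counit of the left and the unit of the right Kan extension at M; the
    canonical morphism for res M is their composite. *)
Definition kan_eps : rmor (KL resM) M := lad_tr KL (M := resM) (N := M) idm_res.
Definition kan_eta : rmor M (KR resM) := rad_tr KR (M := resM) (N := M) idm_res.

Lemma kan_epsK (u : O) (m : M (iota u)) : kan_eps (iota u) (lad_unit KL resM u m) = m.
Proof.
exact: (congr1 (fun g : rmor resM resM => g u m) (lad_trK KL (M := resM) (N := M) idm_res)).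
Qed.

Lemma kan_etaK (u : O) (m : M (iota u)) : rad_counit KR resM u (kan_eta (iota u) m) = m.
Proof.
exact: (congr1 (fun g : rmor resM resM => g u m) (rad_trK KR (M := resM) (N := M) idm_res)).
Qed.

Lemma kan_canonicalE x (n : KL resM x) : kan_canonical KL KR resM x n = kan_eta x (kan_eps x n).
Proof.
rewrite -(@kan_canonical_uniq _ _ _ _ KL KR resM (mor_comp kan_eta kan_eps)) // => u m /=.
by rewrite kan_epsK; exact: kan_etaK.
Qed.

(** The image of the counit is the submodule generated by the values of M on O: the
    counit factors through any submodule P which contains them, as the inclusion of
    res M into res P has a transpose. *)
Lemma kan_eps_sub (P : submod M) : (forall u (m : M (iota u)), P (iota u) m) ->
  forall x (n : KL resM x), P x (kan_eps x n).
Proof.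
move=> PM x n.
pose h (u : O) (m : M (iota u)) : subspace_type (P (iota u)) :=
  SubspaceElt (introT (subspace_predP _ _) (PM u m)).
have hl u : linear (@h u) by move=> a m m'; apply/val_inj.
have hn u v (f : Defs.hom (iota u) (iota v)) m : h u (mact f m) = sub_act f (h v m).
  exact/val_inj.
pose g : rmor resM (restr iota (sub_rmod P)) :=
  @RMor k (full_sub iota) resM (restr iota (sub_rmod P)) h hl hn.
pose incl : rmor (sub_rmod P) M := @RMor k A (sub_rmod P) M (fun x m => \val m)
  (fun u a m m' => erefl) (fun u v f m => erefl).
have -> : kan_eps = mor_comp incl (lad_tr KL g).
  rewrite -[LHS]lad_uniq -[RHS]lad_uniq; congr (lad_tr KL _); apply: rmorP => u m /=.
  rewrite kan_epsK.
  have /= -> := congr1 (fun h : rmor resM (restr iota (sub_rmod P)) => h u m) (lad_trK KL g).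
  by [].
exact: elimT (subspace_predP _ _) (subspace_valP (lad_tr KL g x n)).
Qed.

(** The kernel of the unit is the largest submodule which vanishes on O: if all
    morphisms from O kill n, the morphism represented by the image of n has the same
    transpose as zero. *)
Lemma kan_eta_eq0 x (n : M x) :
  kan_eta x n = 0 <-> forall u (f : Defs.hom (iota u) x), mact f n = 0.
Proof.
split=> [n0 u f|n0].
  by rewrite -(kan_etaK (mact f n)) mfun_nat n0 mact0r mfun0.
have eq0 : mor_comp kan_eta (yoneda n) = 0.
  rewrite -[LHS]rad_uniq -[RHS]rad_uniq; congr (rad_tr KR _); apply: rmorP => u f /=.
  by rewrite n0 !mfun0.
have := congr1 (fun h : rmor (representable x) (KR resM) => h x (idm x)) eq0.
by rewrite /= mact1.
Qed.

End KanImage.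

(** * Linear bijections and modules over presented categories *)

Section LinearBijections.
Variable k : fieldType.

Lemma linear0f (U V : lmodType k) (f : U -> V) : linear f -> f 0 = 0.
Proof. by move=> fl; have := fl (-1) 0 0; rewrite scaler0 addr0 scaleN1r addNr. Qed.

Lemma linearBf (U V : lmodType k) (f : U -> V) : linear f -> {morph f : u v / u - v}.
Proof. by move=> fl u v; rewrite addrC -scaleN1r fl scaleN1r addrC. Qed.

Lemma linear_bij (U V : lmodType k) (f : U -> V) : linear f ->
  (forall u, f u = 0 -> u = 0) -> (forall v, exists u, f u = v) -> bijective f.
Proof.
move=> fl f0 fs; pose g v := sval (cid (fs v)).
have gK : cancel g f by move=> v; exact: svalP (cid (fs v)).
exists g => // u; apply/eqP; rewrite -subr_eq0; apply/eqP/f0.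
by rewrite (linearBf fl) gK subrr.
Qed.

Lemma linear_can_inv (U V : lmodType k) (f : U -> V) g :
  linear f -> cancel f g -> cancel g f -> linear g.
Proof.
by move=> fl fK gK a u v; apply: (can_inj fK); rewrite fl !gK.
Qed.

Lemma linear_mulmx m n (f : 'rV[k]_m -> 'rV[k]_n) : linear f ->
  exists A : 'M[k]_(m, n), forall u, f u = u *m A.
Proof.
move=> fl; exists (\matrix_i f (delta_mx 0 i)) => u.
rewrite {1}[u]row_sum_delta mulmx_sum_row.
have fD : {morph f : u v / u + v} by move=> a b; rewrite -[a in LHS]scale1r fl scale1r.
rewrite (big_morph f fD (linear0f fl)); apply: eq_bigr => i _.
by rewrite rowK -[_ *: _ in LHS]addr0 fl (linear0f fl) addr0.
Qed.

Lemma linear_inj_dim m n (f : 'rV[k]_m -> 'rV[k]_n) : linear f -> injective f -> (m <= n)%N.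
Proof.
move=> fl fi; have [A fA] := linear_mulmx fl.
have : row_free A.
  by apply: inj_row_free => v vA; apply: fi; rewrite fA vA (linear0f fl).
by move/eqP <-; exact: rank_leq_col.
Qed.

Lemma has_dim_unique (V : lmodType k) m n : has_dim V m -> has_dim V n -> m = n.
Proof.
move=> [f [fl [f' fK f'K]]] [g [gl [g' gK g'K]]].
have f'l := linear_can_inv fl fK f'K; have g'l := linear_can_inv gl gK g'K.
apply/eqP; rewrite eqn_leq (@linear_inj_dim _ _ (g' \o f)) ?(@linear_inj_dim _ _ (f' \o g)) //.
- by move=> a u v /=; rewrite gl f'l.
- by apply: inj_comp; [exact: can_inj f'K | exact: can_inj gK].
- by move=> a u v /=; rewrite fl g'l.
- by apply: inj_comp; [exact: can_inj g'K | exact: can_inj fK].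
Qed.

(** Cancel, on both sides of F F = F, the injective factor and the surjective one of
    a full rank factorization of F. *)
Lemma idempotent_factor (d n : nat) (F : 'M[k]_d) : F *m F = F -> \rank F = n ->
  exists (C : 'M[k]_(d, n)) (D : 'M[k]_(n, d)), C *m D = F /\ D *m C = 1%:M.
Proof.
move=> FF <-; exists (col_base F), (row_base F); split; first exact: mulmx_base.
have := mulmx_base F; move: (row_base_free F) (col_base_full F) => /row_freeP[].
move: (col_base F) (row_base F) => C D B' DB /row_fullP[B CB] CD.
have : B *m (C *m D *m (C *m D)) *m B' = B *m (C *m D) *m B' by rewrite CD FF.
by rewrite !mulmxA CB mul1mx -!mulmxA DB !mulmx1.
Qed.

Lemma rank_idempotent_compl d (F : 'M[k]_d) : F *m F = F ->
  \rank (1%:M - F) = (d - \rank F)%N.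
Proof.
move=> FF; rewrite -mxrank_ker; apply/eqP; rewrite eqn_leq; apply/andP; split; apply: mxrankS.
  by apply/sub_kermxP; rewrite mulmxBl mul1mx FF subrr.
rewrite -[kermx F]mulmx1 -[1%:M in X in (X <= _)%MS](subrK F) mulmxDr mulmx_ker addr0.
exact: submxMl.
Qed.

End LinearBijections.

Section PresentedModules.
Variables (k : fieldType) (V : Type) (E : V -> V -> Type).
Variable rel : forall x y, {malg k[(qpath E x y)]} -> Prop.
Local Notation A := (presented rel).

Lemma path_act_nat (M N : V -> lmodType k) (Ma : forall x y, E x y -> M y -> M x)
    (Na : forall x y, E x y -> N y -> N x) (f : forall x, M x -> N x) :
  (forall x y (b : E x y) m, f x (Ma x y b m) = Na x y b (f y m)) ->
  forall x y (p : qpath E x y) m, f x (path_act Ma p m) = path_act Na p (f y m).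
Proof. by move=> fn x y; elim=> [//|x' y' z b p IH] m /=; rewrite fn IH. Qed.

Lemma natural_of_arrows (M N : rmod A) (f : forall x, M x -> N x) :
  (forall x, linear (f x)) ->
  (forall x y (b : E x y) (m : M y),
     f x (mact (pres_arrow rel b : Defs.hom (x : A) y) m) =
     mact (pres_arrow rel b : Defs.hom (x : A) y) (f y m)) ->
  forall (x y : A) (g : Defs.hom x y) m, f x (mact g m) = mact g (f y m).
Proof.
move=> fl fn x y g m; rewrite -[g]qreprK !(mact_lpath (qrepr g)).
rewrite /lpath_act (lin_ext_comp _ _ (fl x)); apply: eq_bigr => p _ /=; congr (_ *: _).
exact: (path_act_nat fn).
Qed.

End PresentedModules.

Section RepModules.
Variables (k : fieldType) (Q : finquiver) (d : zvert (framed Q) -> nat).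
Local Notation zpath := (qpath (@zarr (framed Q))).

Lemma path_act_mx (M : rep k d) x y (p : zpath x y) m :
  path_act (matrix_act M) p m = m *m path_mx M p.
Proof.
by elim: p m => [x'|x' y' z b p IH] m /=; rewrite ?mulmx1 // IH /matrix_act mulmxA.
Qed.

Lemma rep_mact_path (M : rep k d) x y (p : zpath x y) (m : rep_rmod M y) :
  mact (qpi (ideal_sub (@mesh_rel k (framed Q) (@nonfrozen Q)) x y) << p >>
    : Defs.hom (x : nakR k Q) y) m = m *m path_mx M p.
Proof.
rewrite /= (pres_act_pi (matrix_act_lin M) (@rmat_rel _ _ _ M)) /lpath_act.
by rewrite lin_extU path_act_mx.
Qed.

Lemma rep_mact_arrow (M : rep k d) x y (b : zarr x y) (m : rep_rmod M y) :
  mact (pres_arrow (@mesh_rel k (framed Q) (@nonfrozen Q)) b : Defs.hom (x : nakR k Q) y) m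
  = m *m M x y b.
Proof. by rewrite rep_mact_path path_mx1. Qed.

Lemma subspace_sum (U : lmodType k) (W : subspace U) (I : Type) (r : seq I) (c : I -> k)
    (u : I -> U) : (forall i, W (u i)) -> W (\sum_(i <- r) c i *: u i).
Proof.
move=> Wu; elim: r => [|i r IH]; first by rewrite big_nil; exact: subspace0.
by rewrite big_cons; exact: subspaceL.
Qed.

Lemma rep_mact_sub (M : rep k d) (x y : nakR k Q) (f : Defs.hom x y) (m : rep_rmod M y)
    (W : subspace (rep_rmod M x)) :
  (forall p : zpath x y, W (m *m path_mx M p)) -> W (mact f m).
Proof.
move=> Wp; rewrite /= /pres_act /lpath_act /lin_ext; apply: subspace_sum => p.
by rewrite path_act_mx.
Qed.

End RepModules.

(** * The limit point is a direct sum *)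

Section Identification.
Variables (k : fieldType) (Q : finquiver) (d : zvert (framed Q) -> nat).
Local Notation zpath := (qpath (@zarr (framed Q))).
Variables (KL : left_adjoint (@frozen_in k Q)) (KR : right_adjoint (@frozen_in k Q)).
Variable L : rep k d.
Local Notation M := (rep_rmod L).
Local Notation resL := (restr (@frozen_in k Q) M).
Local Notation E := (proj_mx L L).
Local Notation eta := (kan_eta KR M).
Local Notation eps := (kan_eps KL M).
Local Notation KLR := (K_LR KL KR resL).

Lemma fibre_refl : fibre L L. Proof. by []. Qed.

Lemma zero_linear (V : lmodType k) (a : k) (u v : V) : u = 0 -> v = 0 -> a *: u + v = 0.
Proof. by move=> -> ->; rewrite scaler0 addr0. Qed.
Definition zero_subspace (V : lmodType k) : subspace V :=
  Subspace (subspace_mem := fun v => v = 0) erefl (@zero_linear V).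

Lemma kan_eta_radical x (m : 'rV[k]_(d x)) : eta x m = 0 <-> in_radical L m.
Proof.
rewrite kan_eta_eq0; split=> [m0 u p|m0 u f].
  by rewrite -(rep_mact_path p m); exact: m0.
exact: (@rep_mact_sub _ _ _ L (fz u) x f m (zero_subspace _) (m0 u)).
Qed.

Lemma kan_eta_proj_eq0 x (m : 'rV[k]_(d x)) : eta x (m *m E x) = 0 -> m *m E x = 0.
Proof.
by move/kan_eta_radical/(radical_proj L); rewrite -mulmxA (proj_idem fibre_refl).
Qed.

Lemma gen_linear x (a : k) (m m' : 'rV[k]_(d x)) :
  in_radical L (m *m E x - m) -> in_radical L (m' *m E x - m') ->
  in_radical L ((a *: m + m') *m E x - (a *: m + m')).
Proof.
move=> m0 m'0 u p; rewrite [(a *: m + _) *m E x]mulmxDl -scalemxAl opprD addrACA -scalerBr.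
by rewrite mulmxDl -scalemxAl m0 m'0 scaler0 addr0.
Qed.

Lemma gen_zero x : in_radical L ((0 : 'rV[k]_(d x)) *m E x - 0).
Proof. by move=> u p; rewrite mul0mx subr0 mul0mx. Qed.

(** The vectors on which proj_mx is the identity modulo the radical form a submodule
    containing the frozen part, hence contain the image of the counit. *)
Definition gen_at x : subspace (M x) :=
  Subspace (subspace_mem := fun m => in_radical L (m *m E x - m)) (@gen_zero x) (@gen_linear x).

Lemma gen_path x y (p : zpath x y) (m : 'rV[k]_(d y)) :
  in_radical L (m *m E y - m) -> in_radical L (m *m path_mx L p *m E x - m *m path_mx L p).
Proof.
move=> m0; have r0 := radical_path p m0.
have rE : m *m E y *m path_mx L p *m E x = m *m path_mx L p *m E x.
  by apply/eqP; rewrite -subr_eq0 -!mulmxBl (radical_proj L r0).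
have -> : m *m path_mx L p *m E x - m *m path_mx L p =
    (m *m E y - m) *m path_mx L p - m *m (E y *m path_mx L p *m (1%:M - E x)).
  by rewrite mulmxBl !mulmxBr mulmx1 !mulmxA rE opprB [RHS]addrC subrKA.
move=> u q; rewrite mulmxBl r0 (radical_mull m (proj_path_radical p fibre_refl)).
exact: subrr.
Qed.

Lemma gen_act (x y : nakR k Q) (f : Defs.hom x y) m :
  gen_at y m -> gen_at x (mact f m).
Proof. by move=> m0; apply: rep_mact_sub => p; exact: gen_path. Qed.

Definition gen_submod : submod M := Submod gen_act.

Lemma kan_eps_gen x n : in_radical L (eps x n *m E x - eps x n).
Proof.
apply: (@kan_eps_sub _ _ _ _ KL M gen_submod) => u m /=.
by rewrite (proj_frozen fibre_refl u) mulmx1 subrr => v p; rewrite mul0mx.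
Qed.

Lemma kan_eta_proj x n : eta x (eps x n *m E x) = eta x (eps x n).
Proof.
apply/eqP; rewrite -subr_eq0 -(linearBf (mfun_lin eta (x := x))); apply/eqP.
exact/kan_eta_radical/kan_eps_gen.
Qed.

Lemma out_mx_eps x (c : 'rV[k]_(dp_rank (pairing_basis L x))) :
  exists n, eps x n = c *m out_mx L L x.
Proof.
rewrite mulmx_sum_row.
apply: (@subspace_sum _ _ (mor_image eps x) _ _ (fun i => c 0 i)) => i /=.
rewrite row_rows_mx /out_row; case: (dp_row _ _) => u [q j] /=.
rewrite rowE -(rep_mact_path q (delta_mx 0 j)).
apply: (submod_act (s := mor_image eps)).
by exists (lad_unit KL resL u (delta_mx 0 j)); exact: kan_epsK.
Qed.

(** The image of proj_mx is spanned by rows of paths from x to frozen vertices, which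
    act on vectors at frozen vertices, where the counit is surjective. *)
Lemma proj_mx_eps x (m : 'rV[k]_(d x)) : exists n, eps x n = m *m E x.
Proof.
have [n nE] := out_mx_eps (m *m in_mx L L x *m invmx (gram L x)).
by exists n; rewrite nE proj_mxE !mulmxA.
Qed.

Lemma kan_eta_image x (m : 'rV[k]_(d x)) : (m <= E x)%MS ->
  mor_image (kan_canonical KL KR resL) x (eta x m).
Proof.
case/submxP => m' ->; have [n <-] := proj_mx_eps m'.
by exists n; exact: kan_canonicalE.
Qed.

(** The intermediate extension is the image of eta on the image of eps; modulo the
    radical, which eta kills, this is the image of proj_mx. *)
Definition to_KLR x (m : 'rV[k]_(d x)) : KLR x :=
  SubspaceElt (introT (subspace_predP _ _) (kan_eta_image (submxMl m (E x)))).

Lemma to_KLR_linear x : linear (@to_KLR x).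
Proof.
move=> a m m'; apply/val_inj => /=.
by rewrite mulmxDl -scalemxAl (mfun_lin eta).
Qed.

Lemma to_KLR_ker x (m : 'rV[k]_(d x)) : to_KLR m = 0 -> m *m E x = 0.
Proof. by move/(congr1 val) => /= /kan_eta_proj_eq0. Qed.

Lemma to_KLR_surj x (z : KLR x) : exists m, to_KLR m = z.
Proof.
have [n nz] := elimT (subspace_predP _ _) (subspace_valP z).
exists (eps x n); apply/val_inj; rewrite /= kan_eta_proj -nz.
by rewrite -kan_canonicalE.
Qed.

Lemma rank_proj_mx x : \rank (E x) = dp_rank (pairing_basis L x).
Proof.
apply/eqP; rewrite eqn_leq; apply/andP; split.
  by rewrite proj_mxE; do 2!apply: leq_trans (mxrankM_maxl _ _) _;
    exact: rank_leq_col.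
have : \rank (out_mx L L x *m E x *m in_mx L L x) = dp_rank (pairing_basis L x).
  by rewrite (out_proj fibre_refl) mxrank_unit // gram_unit.
by move=> <-; apply: leq_trans (mxrankM_maxl _ _) (mxrankM_maxr _ _).
Qed.

Lemma has_dim_KLR x : has_dim (KLR x) (\rank (E x)).
Proof.
rewrite rank_proj_mx; exists (fun c => to_KLR (c *m out_mx L L x)).
have lin : linear (fun c => to_KLR (c *m out_mx L L x)).
  by move=> a c c'; rewrite mulmxDl -scalemxAl to_KLR_linear.
split=> //; apply: linear_bij => // [c /to_KLR_ker|z].
  rewrite -mulmxA (out_proj fibre_refl) => /(congr1 (mulmx^~ (in_mx L L x))).
  rewrite mul0mx -mulmxA => /(congr1 (mulmx^~ (invmx (gram L x)))).
  by rewrite mul0mx mulmxK // gram_unit.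
have [m <-] := to_KLR_surj z.
have mE : m *m in_mx L L x *m invmx (gram L x) *m out_mx L L x = m *m E x.
  by rewrite proj_mxE !mulmxA.
exists (m *m in_mx L L x *m invmx (gram L x)); rewrite mE; apply/val_inj => /=.
by rewrite -mulmxA (proj_idem fibre_refl).
Qed.

Variable S : rmod (mesh_category k Q).
Hypothesis S_arrow0 : forall x y (b : zarr x y) (m : S y),
  mact (pres_arrow (@mesh_rel k Q xpredT) b : Defs.hom (x : mesh_category k Q) y) m = 0.
Hypothesis S_dim : forall x, has_dim (inflation S x) (d x - \rank (E x)).
Local Notation N := (dsum KLR (inflation S)).

Lemma inflation_arrow0 (x y : zvert (framed Q)) (b : zarr x y) (m : inflation S y) :
  mact (pres_arrow (@mesh_rel k (framed Q) (@nonfrozen Q)) b : Defs.hom (x : nakR k Q) y) m = 0.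
Proof.
rewrite /= (pres_act_pi (@infl_act_lin _ _ S) (@infl_rel _ _ S)) /lpath_act lin_extU /=.
by case: x y b m => -[i|i] p [[j|j] q] b m //=; exact: S_arrow0.
Qed.

(** On the image of E the isomorphism is to_KLR; on the kernel of E, where the arrows
    act by zero in the limit, it is any linear isomorphism to S. *)
Lemma limit_iso : exists2 f : rmor (rep_rmod (limit_rep fibre_refl)) N, is_iso f &
  forall x m, val (f x m).1 = eta x (m *m E x).
Proof.
have Eidem x : E x *m E x = E x by exact: (proj_idem fibre_refl).
have Fidem x : (1%:M - E x) *m (1%:M - E x) = 1%:M - E x.
  by rewrite mulmxBr mulmx1 mulmxBl mul1mx Eidem subrr subr0.
have rF x : \rank (1%:M - E x) = (d x - \rank (E x))%N by exact: rank_idempotent_compl.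
pose n x := (d x - \rank (E x))%N.
have CDex x : {CD : 'M[k]_(d x, n x) * 'M[k]_(n x, d x) |
    CD.1 *m CD.2 = 1%:M - E x /\ CD.2 *m CD.1 = 1%:M}.
  by apply: cid; have [C [D CD]] := idempotent_factor (Fidem x) (rF x); exists (C, D).
pose C x := (sval (CDex x)).1; pose D x := (sval (CDex x)).2.
have CD x : C x *m D x = 1%:M - E x by exact: ((svalP (CDex x)).1).
have DC x : D x *m C x = 1%:M by exact: ((svalP (CDex x)).2).
have EC x : E x *m C x = 0.
  by rewrite -[C x]mulmx1 -(DC x) !mulmxA -(mulmxA (E x)) CD mulmxBr mulmx1 Eidem subrr mul0mx.
have DE x : D x *m E x = 0.
  by rewrite -[D x]mul1mx -(DC x) -!mulmxA (mulmxA (C x)) CD mulmxBl mul1mx Eidem subrr mulmx0.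
pose phi x := sval (cid (S_dim x)).
have phi_lin x : linear (phi x) by exact: ((svalP (cid (S_dim x))).1).
have phi_bij x : bijective (phi x) by exact: ((svalP (cid (S_dim x))).2).
(* C and D are coordinates on the kernel of E and their inverse *)
pose f x (m : 'rV[k]_(d x)) : N x := (to_KLR m, phi x (m *m C x)).
have f_lin x : linear (f x).
  move=> a m m'; congr pair; first exact: to_KLR_linear.
  by rewrite mulmxDl -scalemxAl phi_lin.
have f_nat := @natural_of_arrows _ _ _ _ (rep_rmod (limit_rep fibre_refl)) N f f_lin.
have f_act (x y : nakR k Q) (g : Defs.hom x y) m :
    f x (mact (r := rep_rmod (limit_rep fibre_refl)) g m) = mact g (f y m).
  apply: f_nat => {g m}x' y' b m; rewrite rep_mact_arrow /f.
  congr pair; last first.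
    by rewrite inflation_arrow0 -!mulmxA EC !mulmx0 (linear0f (phi_lin x')).
  apply/val_inj => /=.
  rewrite -(mfun_nat eta) -/(pres_arrow _ _) (@rep_mact_arrow _ _ _ L).
  apply/eqP; rewrite -subr_eq0 -(linearBf (mfun_lin eta (x := x'))); apply/eqP.
  apply/kan_eta_radical.
  rewrite !mulmxA -(mulmxA _ (E x') (E x')) Eidem -(path_mx1 L b).
  apply: (@gen_path _ _ (path1 b)) => u p.
  by rewrite -mulmxA Eidem subrr mul0mx.
exists (@RMor _ _ (rep_rmod (limit_rep fibre_refl)) N f f_lin f_act) => // x /=.
apply: (linear_bij (f_lin x)) => [m fm|[z t]].
  have mE := to_KLR_ker (congr1 fst fm).
  have mC : m *m C x = 0.
    by apply: (bij_inj (phi_bij x)); rewrite (linear0f (phi_lin x)); exact: (congr1 snd fm).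
  by rewrite -[m]mulmx1 -(subrK (E x) 1%:M) -CD mulmxDr mE mulmxA mC mul0mx addr0.
have [m0 <-] := to_KLR_surj z; have [phi' _ phi'K] := phi_bij x.
exists (m0 *m E x + phi' t *m D x); congr pair.
  by apply/val_inj; rewrite /= mulmxDl -!mulmxA Eidem DE mulmx0 addr0.
by rewrite mulmxDl -!mulmxA EC DC mulmx0 mulmx1 add0r phi'K.
Qed.

End Identification.

(** * The closed orbit *)

Section OrbitOf.
Variables (k : fieldType) (Q : finquiver) (v w : {fsfun zvert Q -> nat with 0%N}).
Local Notation d := (dimvec v w).
Variables (L L0 : rep k d) (N : rmod (nakR k Q)).
Variable psi : rmor (restr (@frozen_in k Q) (rep_rmod L)) (restr (@frozen_in k Q) N).

Lemma base_change_mor (G : forall x, 'M[k]_(d x)) (M M' : rep k d) :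
  base_change G M M' ->
  exists f : rmor (rep_rmod M') (rep_rmod M), forall x m, f x m = m *m G x.
Proof.
move=> GM; pose f x (m : rep_rmod M' x) : rep_rmod M x := m *m G x.
have fl x : linear (f x) by move=> a m n; rewrite /f mulmxDl scalemxAl.
have fn := @natural_of_arrows _ _ _ _ (rep_rmod M') (rep_rmod M) f fl.
have {}fn : forall (x y : nakR k Q) (g : Defs.hom x y) m, f x (mact g m) = mact g (f y m).
  by apply: fn => x y b m; rewrite !rep_mact_arrow /f -!mulmxA GM.
by exists (RMor fl fn).
Qed.

Lemma mor_base_change (M M' : rep k d) (f : rmor (rep_rmod M') (rep_rmod M)) : is_iso f ->
  exists2 G : forall x, 'M[k]_(d x), (forall x, G x \in unitmx) /\
    (forall x m, f x m = m *m G x) & base_change G M M'.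
Proof.
move=> fb; have ex x := cid (linear_mulmx (mfun_lin f (x := x))).
pose G x := sval (ex x); have fG x m : f x m = m *m G x by exact: (svalP (ex x)).
exists G; first split=> // x.
  rewrite -row_free_unit; apply: inj_row_free => m mG.
  by apply: (bij_inj (fb x)); rewrite fG mG mfun0.
move=> x y b; apply/row_matrixP => i; rewrite !rowE !mulmxA -(fG y).
by rewrite -(fG x) -(rep_mact_arrow b) (mfun_nat f) rep_mact_arrow.
Qed.

(** Two points isomorphic to N compatibly with psi are isomorphic by a base change
    which is the identity at the frozen vertices, and conversely. *)
Lemma orbit_ofE : orbit_of psi L0 -> orbit_of psi = gorbit L0.
Proof.
case=> f0 f0b f0psi; apply/seteqP; split=> M.
  case=> f fb fpsi; apply/gorbitP.
  pose g x := sval (cid2 (let: Bijective g fK gK := f0b x in ex_intro2 _ _ g fK gK)).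
  have f0K x : cancel (f0 x) (g x) by rewrite /g; case: cid2.
  have gK x : cancel (g x) (f0 x) by rewrite /g; case: cid2.
  pose h x (m : rep_rmod M x) : rep_rmod L0 x := g x (f x m).
  have hl x : linear (h x).
    by move=> a m n; rewrite /h (mfun_lin f) (linear_can_inv (mfun_lin f0 (x := x)) (f0K x) (gK x)).
  have hn (x y : nakR k Q) (b : Defs.hom x y) m : h x (mact b m) = mact b (h y m).
    by apply: (can_inj (f0K x)); rewrite mfun_nat /h !gK mfun_nat.
  have [G [Gu GE] GM] := @mor_base_change L0 M (RMor hl hn) (fun x =>
    bij_comp (Bijective (gK x) (f0K x)) (fb x)).
  exists G => //; split=> // u; apply/row_matrixP => i.
  by rewrite rowE -GE /= /h fpsi -f0psi f0K row1.
case/gorbitP => G [Gu G1] GM; have [h hE] := base_change_mor GM.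
exists (mor_comp f0 h) => [x|u m].
  apply: bij_comp; first exact: f0b.
  exists (fun m => m *m invmx (G x)) => m; rewrite hE ?mulmxK ?mulmxKV //.
by rewrite /= hE G1 mulmx1 f0psi.
Qed.

End OrbitOf.

Theorem proposition2p12 (R : realType) (Q : finquiver)
    (v w v0 : {fsfun zvert Q -> nat with 0%N})
    (KL : left_adjoint (@frozen_in R[i] Q))
    (KR : right_adjoint (@frozen_in R[i] Q))
    (L : rep R[i] (dimvec v w))
    (S : rmod (mesh_category R[i] Q)) :
  acyclic Q ->
  stable (rep_rmod L) ->
  graded_quiver_variety R[i] v w (gorbit L) ->
  let resL := restr (@frozen_in R[i] Q) (rep_rmod L) in
  has_dimvec (K_LR KL KR resL) (dimvec v0 w) ->
  semisimple S ->
  has_dimvec S (fun x => (v x - v0 x)%N) ->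
  let N := dsum (K_LR KL KR resL) (inflation S) in
  let psi : rmor resL (restr (@frozen_in R[i] Q) N) :=
    mor_comp (restr_mor _ (dsum_inl (K_LR KL KR resL) (inflation S)))
             (K_LR_unit KL KR resL) in
  unique (closed_orbit_in (zariski_closure (gorbit L))) (orbit_of psi).
Proof.
move=> Qac _ _ resL KLR_dim S_ss S_dim N psi.
have k0 : [pchar R[i]] =i pred0 by exact: Num.Theory.pchar_num.
have [a [a' [a_gt0 a'_gt0 aP]]] := arrow_weights Qac v w.
pose fibL := @fibre_refl _ _ _ L.
have S0 x y (b : zarr x y) (m : S y) := semisimple_arrow0 Qac b m S_ss.
have rkE x : \rank (proj_mx L L x) = dimvec v0 w x.
  exact: has_dim_unique (has_dim_KLR KL KR L x) (KLR_dim x).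
have inflS_dim x : has_dim (inflation S x) (dimvec v w x - \rank (proj_mx L L x)).
  case: x => -[i|i] p; first by rewrite rkE; exact: S_dim.
  rewrite (proj_frozen fibL (i, p)) mxrank1 subnn.
  by exists id; split=> //; exists id.
have in_closure M (MF : fibre L M) : zariski_closure (gorbit M) (limit_rep MF).
  apply: (limit_in_closure MF a_gt0 a'_gt0 aP k0) => G P Gu G1 GP.
  by apply/gorbitP; exists G.
pose L0 := limit_rep fibL.
have L0psi : orbit_of psi L0.
  have [f fb fE] := limit_iso KL KR S0 inflS_dim; exists f => // u m.
  apply/eqP; rewrite -pair_eqE; apply/andP; split; apply/eqP; last by rewrite thinmx0.
  apply/val_inj; rewrite fE (proj_frozen fibL) mulmx1.
  by rewrite -[in LHS](kan_epsK KL (M := rep_rmod L) (u := u) m) -kan_canonicalE.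
have locus_orbit P : split_locus L P <-> gorbit L0 P.
  split=> [LP|/gorbitP[G [Gu G1] GP]]; last first.
    exact: (base_change_split Gu G1 GP (limit_split fibL)).
  have [G GP1 GP] := split_locus_base_change (limit_split fibL) LP.
  by apply/gorbitP; exists G.
have L0E : gorbit L0 = split_locus L by apply/seteqP; split=> P /locus_orbit.
rewrite (orbit_ofE L0psi); split.
  split; first by exists L0.
    rewrite L0E; exact: split_locus_closed.
  by move=> P; apply: gorbit_closure; exact: in_closure.
move=> _ [[M ->] Mcl Msub].
have MF : fibre L M.
  apply: (zariski_closure_sub (@fibre_closed _ _ _ L)) (Msub _ (gorbit_refl M)) => P.
  by case/gorbitP => G [Gu G1] GP; apply: base_change_fibre GP _.
have : gorbit M (limit_rep MF).
  by apply: (zariski_closure_sub Mcl) (in_closure _ MF).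
move/gorbit_eq ->; apply: gorbit_eq; apply/locus_orbit; exact: limit_split.
Qed.
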